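(* Let $a\in\mathscr{A}$. Then $\mathfrak{M}(\overline{a})=\mathscr{M}(\overline{a})\cap H^{\infty}$.
   Context: Let $\mathbb{D}=\{|z|<1\}$, $\mathbb{T}=\partial\mathbb{D}$, let $\mathscr{O}(\mathbb{D})$ be the set of analytic functions on $\mathbb{D}$, $H^2$ the Hardy space of $\mathbb{D}$ (identified with a closed subspace of $L^2=L^2(\mathbb{T},d\theta/2\pi)$ via radial boundary values), and $H^\infty$ the bounded analytic functions on $\mathbb{D}$. For $a\in H^\infty$, the co-analytic Toeplitz operator $T_{\overline a}:H^2\to H^2$ is $T_{\overline a}f=P_+(\overline a f)$, where $P_+$ is the orthogonal projection of $L^2$ onto $H^2$. The range space is $\mathscr{M}(\overline a):=T_{\overline a}H^2$, and its set of multipliers into itself is $$\mathfrak{M}(\overline{a}):=\{\phi\in\mathscr{O}(\mathbb{D}):\ \forall f\in\mathscr{M}(\overline{a}),\ \phi f\in\mathscr{M}(\overline{a})\}.$$ $\mathscr{A}$ denotes the set of polynomials of the form $a(z)=\prod_{j=1}^{N}(z-\zeta_j)$ with $\zeta_j\in\mathbb{T}$ (not necessarily distinct), the case $N=0$ (empty product, $a=1$) being allowed. *)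

(* Defs.v *)
From HB Require Import structures.
From mathcomp Require Import all_boot all_order all_algebra.
From mathcomp Require Import complex.
From mathcomp Require Import all_classical all_reals all_analysis.

Set Implicit Arguments.
Unset Strict Implicit.
Unset Printing Implicit Defensive.

Import Order.TTheory GRing.Theory Num.Theory.
Import numFieldNormedType.Exports.

Local Open Scope classical_set_scope.
Local Open Scope ring_scope.
Local Open Scope complex_scope.

(* A function on the open unit disc, or on the unit circle, is represented by
   a total function R[i] -> R[i] whose values elsewhere are junk.  Every
   predicate below only depends on the values on the disc (resp. the circle),
   so equality of two sets of functions on the disc is equality of the
   corresponding sets of total functions. *)

Section Hardy.
Variable R : realType.
Implicit Types (f g h phi a F G H A : R[i] -> R[i]).

Definition cabs (z : R[i]) : R := ComplexField.Normc.normc z.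

Definition expi (t : R) : R[i] := cos t +i* sin t.

(* Differentiability is over R[i], i.e. complex differentiability. *)
Definition analytic_disc : set (R[i] -> R[i]) :=
  [set f | forall z : R[i], `|z| < 1 -> derivable (f : R[i]^o -> R[i]^o) z 1].

Definition Hinf : set (R[i] -> R[i]) :=
  [set f | analytic_disc f /\
           exists M : R[i], forall z : R[i], `|z| < 1 -> `|f z| <= M].

(* Square-summable Taylor coefficients at the origin. *)
Definition H2 : set (R[i] -> R[i]) :=
  [set f | analytic_disc f /\
    exists c : nat -> R[i],
      cvgn (series (fun n => cabs (c n) ^+ 2)) /\
      forall z : R[i], `|z| < 1 ->
        (series (fun n => c n * z ^+ n) : nat -> R[i]^o) @ \oo --> (f z : R[i]^o)].

Definition angles : set R := `[0, 2 * pi]%classic.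

Definition L2 : set (R[i] -> R[i]) :=
  [set F | [/\ measurable_fun angles (fun t => complex.Re (F (expi t))),
               measurable_fun angles (fun t => complex.Im (F (expi t))) &
   (\int[lebesgue_measure]_(t in angles) (cabs (F (expi t)) ^+ 2)%:E < +oo)%E]].

(* Integral against the normalised arc length, of F : T -> R[i]. *)
Definition circle_mean F : R[i] :=
  ((2 * pi)^-1 * \int[lebesgue_measure]_(t in angles) complex.Re (F (expi t))) +i*
  ((2 * pi)^-1 * \int[lebesgue_measure]_(t in angles) complex.Im (F (expi t))).

Definition L2dot F G : R[i] := circle_mean (fun z => F z * conjc (G z)).

(* F is the almost everywhere radial limit of f. *)
Definition boundary_value f F : Prop :=
  {ae @lebesgue_measure R, forall t, angles t ->
     (f (r%:C * expi t) : R[i]^o) @[r --> (1 : R)^'-] --> (F (expi t) : R[i]^o)}.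

Definition H2circle : set (R[i] -> R[i]) :=
  [set F | L2 F /\ exists2 f, H2 f & boundary_value f F].

(* P_+ is the orthogonal projection of L2 onto H2circle.
   Functional relations "P_+ F = G" and "T_{conj a} f = g"; they determine G up
   to a null set and g on the disc. *)
Definition P_plus F G : Prop :=
  [/\ L2 F, H2circle G & forall H, H2circle H -> L2dot (fun z => F z - G z) H = 0].

Definition coToeplitz a f g : Prop :=
  [/\ H2 f, H2 g & exists A F G,
    [/\ boundary_value a A, boundary_value f F, boundary_value g G &
        P_plus (fun z => conjc (A z) * F z) G]].

Definition coToeplitz_range a : set (R[i] -> R[i]) :=
  [set g | exists2 f, H2 f & coToeplitz a f g].

Definition multipliers (M : set (R[i] -> R[i])) : set (R[i] -> R[i]) :=
  [set phi | analytic_disc phi /\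
             forall f, M f -> M (fun z => phi z * f z)].

Definition circle_polys : set {poly R[i]} :=
  [set a | exists N (zeta : 'I_N -> R[i]),
     (forall j, `|zeta j| = 1) /\ a = \prod_(j < N) ('X - (zeta j)%:P)].

End Hardy.

(* Main.v *)
(** Everything reduces to the identity [M(conj a) = a H^2 + {polynomials of degree < N}], where the functions in [H^2] are restricted to those having radial limits almost everywhere; Fatou's theorem on the existence of radial limits is never needed. On the circle [conj a = kappa z^-N a], so [g = T_(conj a) f] holds if and only if [z^N g = kappa a f - p] with [deg p < N], and a Bezout relation between [z^N] and [a] turns this into [g = a h + q]. Fourier coefficients of boundary values are identified with Taylor coefficients by Fatou's lemma, applied to Abel-type polynomial approximations.

If [phi] and [f = a h0 + q0] are in the range and [phi = a h1 + q1] is bounded, then [phi f = a (phi h0 + h1 q0) + q1 q0] is again of this form, since bounded functions multiply [H^2] into itself.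

Conversely [1] is in the range, so a multiplier [phi] is in the range. If [phi] were unbounded, a lacunary sequence [z_j] with [|phi(z_j)|] growing fast and converging to a point [w] would give a test function [h = sum_j eps_j s_j / (1 - conj(z_j) z)], [s_j = sqrt (1 - |z_j|^2)], in [H^2], smooth on the closed disc except at [w], with [|h(z_j)| s_j >= eps_j / 2]. From [phi a h = a k + q] a growth estimate at the zeros of [a] forces [q = 0], so [phi h = k] is in [H^2]; then [|phi(z_j) h(z_j)| s_j] is bounded, a contradiction. *)

Require Import Defs.
From mathcomp Require Import all_boot all_order all_algebra.
From mathcomp Require Import complex.
From mathcomp Require Import all_classical all_reals all_analysis measurable_realfun.
From mathcomp Require Import ring lra.

Set Implicit Arguments.
Unset Strict Implicit.
Unset Printing Implicit Defensive.

Import Order.TTheory GRing.Theory Num.Theory.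
Import numFieldNormedType.Exports.

Local Open Scope classical_set_scope.
Local Open Scope ring_scope.
Local Open Scope complex_scope.

#[local] Arguments cabs : simpl never.

(** * The complex modulus *)

Section ComplexModulus.
Variable R : realType.
Implicit Types (z w : R[i]) (x y : R).

(** The definition of [coToeplitz] asks for radial limits, so every function built on the way has to
    come with its own: hence the [has_boundary_value] conditions, and hence the single cluster point
    [w]. A circle point other than [w] keeps a positive distance from all [z_j], so the test
    function is continuous there and has limits off a null set.

    The product of two functions of [H^2] need not lie in [H^2], so [phi h - k = q / a] could a
    priori have poles at the zeros of [a]. On the radius ending at such a zero, however, the factor
    [a] in [phi = a h1 + q1] absorbs the growth [(1 - r)^(-1/2)] of [h1], and [phi] stays bounded.
    So [q / a] grows at most like [(1 - r)^(-1/2)], slower than a simple pole, and [q] vanishes at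
    the zeros of [a] with multiplicity, while its degree is below their number.

    A gliding hump takes the place of a closed graph argument: the range carries no norm here, and
    one explicit [h] contradicts unboundedness. Weights [4^-(j+1)] against values [8^(j+1)] leave
    [2^j] after halving. *)

Lemma normr_cabs z : `|z| = (cabs z)%:C.
Proof. by []. Qed.

Lemma lt_cabs z x : (`|z| < x%:C) = (cabs z < x).
Proof. by rewrite normr_cabs ltcR. Qed.

Lemma cabs_ge0 z : 0 <= cabs z.
Proof. by rewrite -ler0c -normr_cabs normr_ge0. Qed.

Lemma cabsM z w : cabs (z * w) = cabs z * cabs w.
Proof. exact: ComplexField.Normc.normcM. Qed.

Lemma cabsD z w : cabs (z + w) <= cabs z + cabs w.
Proof. exact: le_normcD. Qed.

Lemma cabsN z : cabs (- z) = cabs z.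
Proof. exact: normcN. Qed.

Lemma cabsB z w : cabs (z - w) = cabs (w - z).
Proof. by rewrite -cabsN opprB. Qed.

Lemma cabs_ltriangle z w : cabs z <= cabs w + cabs (z - w).
Proof. by have := cabsD w (z - w); rewrite addrC subrK. Qed.

Lemma cabs0 : cabs (0 : R[i]) = 0.
Proof. exact: ComplexField.Normc.normc0. Qed.

Lemma cabs1 : cabs (1 : R[i]) = 1.
Proof. exact: ComplexField.Normc.normc1. Qed.

Lemma cabsV z : cabs z^-1 = (cabs z)^-1.
Proof. exact: ComplexField.Normc.normcV. Qed.

Lemma cabsX z n : cabs (z ^+ n) = cabs z ^+ n.
Proof. by elim: n => [|n IH]; rewrite ?expr0 ?cabs1 // !exprS cabsM IH. Qed.

Lemma cabs_eq0 z : (cabs z == 0) = (z == 0).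
Proof.
apply/eqP/eqP => [|->]; first exact: ComplexField.Normc.eq0_normc.
exact: cabs0.
Qed.

Lemma cabs_real x : cabs x%:C = `|x|.
Proof. by rewrite /cabs /= expr0n /= addr0 sqrtr_sqr. Qed.

Lemma sqr_cabs z : cabs z ^+ 2 = complex.Re z ^+ 2 + complex.Im z ^+ 2.
Proof. by case: z => a b; rewrite /cabs /= sqr_sqrtr // addr_ge0 // sqr_ge0. Qed.

Lemma cabs_conjc z : cabs (conjc z) = cabs z.
Proof. by case: z => a b; rewrite /cabs /= sqrrN. Qed.

Lemma mul_conjc z : z * conjc z = (cabs z ^+ 2)%:C.
Proof. by rewrite -sqr_normc normr_cabs -rmorphXn. Qed.

Lemma Re_le_cabs z : `|complex.Re z| <= cabs z.
Proof. by rewrite -lecR; apply: normc_ge_Re. Qed.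

Lemma Im_le_cabs z : `|complex.Im z| <= cabs z.
Proof.
rewrite -[leRHS]ger0_norm ?cabs_ge0 // -ler_sqr ?nnegrE // !real_normK ?num_real //.
by rewrite sqr_cabs lerDr sqr_ge0.
Qed.

Lemma cabs_le_ReIm z : cabs z <= `|complex.Re z| + `|complex.Im z|.
Proof.
rewrite -ler_sqr ?nnegrE ?cabs_ge0 ?addr_ge0 // sqr_cabs sqrrD !real_normK ?num_real //.
by have := mulr_ge0 (normr_ge0 (complex.Re z)) (normr_ge0 (complex.Im z)); lra.
Qed.

Lemma cabs_sum (I : Type) (r : seq I) (P : pred I) (F : I -> R[i]) :
  cabs (\sum_(i <- r | P i) F i) <= \sum_(i <- r | P i) cabs (F i).
Proof.
elim/big_rec2: _ => [|i y1 y2 _ le12]; first by rewrite cabs0.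
by apply: le_trans (cabsD _ _) _; rewrite lerD2l.
Qed.

(** A positive element of [R[i]] has imaginary part zero, so neighbourhood radii taken in [R[i]] are
    real radii. This moves limits in [R[i]^o] to real limits, where squeezing is possible. *)
Lemma cvg_cabsP (T : Type) (F : set_system T) {FF : Filter F} (f : T -> R[i]) l :
  (f x : R[i]^o) @[x --> F] --> (l : R[i]^o) <-> cabs (f x - l) @[x --> F] --> (0 : R).
Proof.
split => [/cvgrPdist_lt fl|/cvgrPdist_lt fl]; apply/cvgrPdist_lt => e e0.
- have e0C : (0 : R[i]) < e%:C by rewrite (ltcR 0 e).
  apply: filterS (fl _ e0C) => x.
  by rewrite lt_cabs cabsB sub0r normrN ger0_norm ?cabs_ge0.
- have [er ei] : 0 < complex.Re e /\ complex.Im e = 0.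
    by move: e0; rewrite ltcE /= => /andP[/eqP -> ->].
  have := fl _ er; apply: filterS => x.
  rewrite sub0r normrN ger0_norm ?cabs_ge0 // => h.
  by rewrite [e]complexE ei mulr0 addr0 lt_cabs cabsB.
Qed.

Lemma cvg0_le (T : Type) (F : set_system T) {FF : Filter F} (f g : T -> R) :
  (\forall x \near F, 0 <= f x <= g x) -> g @ F --> (0 : R) -> f @ F --> (0 : R).
Proof. by move=> fg g0; apply: (squeeze_cvgr fg) => //; apply: cvg_cst. Qed.

Lemma cvg0_Ml (T : Type) (F : set_system T) {FF : Filter F} (a : R) (f : T -> R) :
  f x @[x --> F] --> (0 : R) -> a * f x @[x --> F] --> (0 : R).
Proof. by move=> f0; rewrite -[X in _ --> X](mulr0 a); apply: cvgM => //; apply: cvg_cst. Qed.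

Lemma cvg0_D (T : Type) (F : set_system T) {FF : Filter F} (f g : T -> R) :
  f x @[x --> F] --> (0 : R) -> g x @[x --> F] --> (0 : R) ->
  f x + g x @[x --> F] --> (0 : R).
Proof. by move=> f0 g0; rewrite -[X in _ --> X]addr0; apply: cvgD. Qed.

Lemma cabs_expi (t : R) : cabs (expi t) = 1.
Proof. by rewrite /cabs /expi /= cos2Dsin2 sqrtr1. Qed.

Lemma expiX (t : R) n : expi t ^+ n = expi (n%:R * t).
Proof.
elim: n => [|n IH]; first by rewrite expr0 mul0r /expi cos0 sin0.
rewrite exprS IH /expi.
have -> : n.+1%:R * t = t + n%:R * t by rewrite -natr1; ring.
rewrite cosD sinD; congr (_ +i* _).
by rewrite addrC.
Qed.

Lemma expi_conjc (t : R) : expi t * conjc (expi t) = 1.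
Proof. by rewrite mul_conjc cabs_expi expr1n. Qed.

End ComplexModulus.

(** * Integrals over the circle *)

Section CircleIntegrals.
Variable R : realType.
Implicit Types (F G : R[i] -> R[i]).

Local Notation mu := (@lebesgue_measure R).
Local Notation angles := (@angles R : set (measurableTypeR R)).

Definition circle_measurable F :=
  measurable_fun angles (fun t => complex.Re (F (expi t))) /\
  measurable_fun angles (fun t => complex.Im (F (expi t))).

Definition circle_integrable F :=
  mu.-integrable angles (EFin \o (fun t => complex.Re (F (expi t)))) /\
  mu.-integrable angles (EFin \o (fun t => complex.Im (F (expi t)))).

Lemma measurable_angles : measurable angles.
Proof. exact: measurable_itv. Qed.

Lemma pi2_gt0 : 0 < 2 * pi :> R.
Proof. by rewrite mulr_gt0 ?pi_gt0. Qed.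

Lemma mu_angles : mu angles = (2 * pi)%:E.
Proof. by rewrite lebesgue_measure_itv /= lte_fin pi2_gt0 sube0. Qed.

Lemma integrable_cst_angles (x : R) : mu.-integrable angles (EFin \o cst x).
Proof.
apply: continuous_compact_integrable; first exact: segment_compact.
by move=> y; apply: cvg_cst.
Qed.

Lemma Re_mulc (x y : R[i]) :
  complex.Re (x * y) = complex.Re x * complex.Re y - complex.Im x * complex.Im y.
Proof. by case: x => ? ?; case: y. Qed.

Lemma Im_mulc (x y : R[i]) :
  complex.Im (x * y) = complex.Re x * complex.Im y + complex.Im x * complex.Re y.
Proof. by case: x => ? ?; case: y. Qed.

Lemma Re_addc (x y : R[i]) : complex.Re (x + y) = complex.Re x + complex.Re y.
Proof. by case: x => ? ?; case: y. Qed.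

Lemma Im_addc (x y : R[i]) : complex.Im (x + y) = complex.Im x + complex.Im y.
Proof. by case: x => ? ?; case: y. Qed.

Lemma Re_oppc (x : R[i]) : complex.Re (- x) = - complex.Re x.
Proof. by case: x. Qed.

Lemma Im_oppc (x : R[i]) : complex.Im (- x) = - complex.Im x.
Proof. by case: x. Qed.

Lemma Re_conjc (x : R[i]) : complex.Re (conjc x) = complex.Re x.
Proof. by case: x. Qed.

Lemma Im_conjc (x : R[i]) : complex.Im (conjc x) = - complex.Im x.
Proof. by case: x. Qed.

Lemma circle_measurableM F G :
  circle_measurable F -> circle_measurable G -> circle_measurable (fun z => F z * G z).
Proof.
move=> [F1 F2] [G1 G2]; split.
- under eq_fun do rewrite Re_mulc.
  apply: measurable_funD; first exact: measurable_funM.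
  by apply: measurable_funN; apply: measurable_funM.
- under eq_fun do rewrite Im_mulc.
  by apply: measurable_funD; apply: measurable_funM.
Qed.

Lemma circle_measurableD F G :
  circle_measurable F -> circle_measurable G -> circle_measurable (fun z => F z + G z).
Proof.
move=> [F1 F2] [G1 G2]; split.
- by under eq_fun do rewrite Re_addc; apply: measurable_funD.
- by under eq_fun do rewrite Im_addc; apply: measurable_funD.
Qed.

Lemma circle_measurableN F :
  circle_measurable F -> circle_measurable (fun z => - F z).
Proof.
move=> [F1 F2]; split.
- by under eq_fun do rewrite Re_oppc; apply: measurable_funN.
- by under eq_fun do rewrite Im_oppc; apply: measurable_funN.
Qed.

Lemma circle_measurableB F G :
  circle_measurable F -> circle_measurable G -> circle_measurable (fun z => F z - G z).
Proof. by move=> mF mG; apply: circle_measurableD => //; apply: circle_measurableN. Qed.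

Lemma circle_measurable_conjc F :
  circle_measurable F -> circle_measurable (fun z => conjc (F z)).
Proof.
move=> [F1 F2]; split.
- by under eq_fun do rewrite Re_conjc.
- by under eq_fun do rewrite Im_conjc; apply: measurable_funN.
Qed.

Lemma circle_measurable_cst (c : R[i]) : circle_measurable (fun=> c).
Proof. by split; apply: measurable_cst. Qed.

Lemma circle_measurable_id : circle_measurable id.
Proof.
split; apply: measurable_funTS; apply: continuous_measurable_fun.
- exact: continuous_cos.
- exact: continuous_sin.
Qed.

Lemma circle_measurable_poly (p : {poly R[i]}) : circle_measurable (horner p).
Proof.
elim/poly_ind: p => [|p c IH].
  have -> : horner (0 : {poly R[i]}) = (fun=> 0) by apply/funext => z; rewrite horner0.
  exact: circle_measurable_cst.
have -> : horner (p * 'X + c%:P) = (fun z => p.[z] * z + c).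
  by apply/funext => z; rewrite !hornerE.
apply: circle_measurableD; last exact: circle_measurable_cst.
by apply: circle_measurableM => //; apply: circle_measurable_id.
Qed.

Lemma measurable_sqr_cabs F : circle_measurable F ->
  measurable_fun angles (fun t => cabs (F (expi t)) ^+ 2).
Proof.
move=> [F1 F2]; under eq_fun do rewrite sqr_cabs.
by apply: measurable_funD; apply: measurable_funX.
Qed.

Lemma circle_integrable_le F (g : R -> R) : circle_measurable F ->
  mu.-integrable angles (EFin \o g) ->
  (forall t, angles t -> cabs (F (expi t)) <= g t) -> circle_integrable F.
Proof.
move=> [F1 F2] ig Fg; split.
- apply: (le_integrable measurable_angles _ _ ig).
    exact/measurable_EFinP.
  move=> t at_; rewrite /= lee_fin (le_trans (Re_le_cabs _))//.
  by rewrite (le_trans (Fg _ at_)) ?ler_norm.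
- apply: (le_integrable measurable_angles _ _ ig).
    exact/measurable_EFinP.
  move=> t at_; rewrite /= lee_fin (le_trans (Im_le_cabs _))//.
  by rewrite (le_trans (Fg _ at_)) ?ler_norm.
Qed.

Lemma circle_integrableD F G : circle_integrable F -> circle_integrable G ->
  circle_integrable (fun z => F z + G z).
Proof.
move=> [F1 F2] [G1 G2]; split.
- have -> : EFin \o (fun t => complex.Re (F (expi t) + G (expi t))) =
     (EFin \o (fun t => complex.Re (F (expi t)))) \+
     (EFin \o (fun t => complex.Re (G (expi t)))).
    by apply/funext => t; rewrite /= Re_addc.
  exact: (integrableD measurable_angles).
- have -> : EFin \o (fun t => complex.Im (F (expi t) + G (expi t))) =
     (EFin \o (fun t => complex.Im (F (expi t)))) \+
     (EFin \o (fun t => complex.Im (G (expi t)))).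
    by apply/funext => t; rewrite /= Im_addc.
  exact: (integrableD measurable_angles).
Qed.

Lemma circle_mean_eq F G : (forall t, angles t -> F (expi t) = G (expi t)) ->
  circle_mean F = circle_mean G.
Proof.
move=> FG; rewrite /circle_mean; congr (_ * _ +i* (_ * _)); apply: eq_Rintegral => t;
  by rewrite inE => /FG ->.
Qed.

Lemma circle_mean_ae F G : circle_measurable F -> circle_measurable G ->
  {ae mu, forall t, angles t -> F (expi t) = G (expi t)} ->
  circle_mean F = circle_mean G.
Proof.
move=> [F1 F2] [G1 G2] FG; rewrite /circle_mean; congr (_ * fine _ +i* (_ * fine _));
  (apply: ae_eq_integral => //; [exact: measurable_angles | exact/measurable_EFinP |
   exact/measurable_EFinP | by apply: filterS FG => t FG /FG /= ->]).
Qed.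

Lemma circle_meanD F G : circle_integrable F -> circle_integrable G ->
  circle_mean (fun z => F z + G z) = circle_mean F + circle_mean G.
Proof.
move=> [F1 F2] [G1 G2]; rewrite /circle_mean.
transitivity (((2 * pi)^-1 * (\int[mu]_(t in angles) complex.Re (F (expi t)) +
   \int[mu]_(t in angles) complex.Re (G (expi t)))) +i*
   ((2 * pi)^-1 * (\int[mu]_(t in angles) complex.Im (F (expi t)) +
   \int[mu]_(t in angles) complex.Im (G (expi t))))); last by rewrite !mulrDr.
congr (_ * _ +i* (_ * _)); rewrite -RintegralD //; try exact: measurable_angles;
  by apply: eq_Rintegral => t _; rewrite ?Re_addc ?Im_addc.
Qed.

Lemma circle_mean_conjc F :
  circle_integrable F -> circle_mean (fun z => conjc (F z)) = conjc (circle_mean F).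
Proof.
move=> [F1 F2]; rewrite /circle_mean /= -mulrN; congr (_ * _ +i* (_ * _)).
  by apply: eq_Rintegral => t _; rewrite Re_conjc.
rewrite -mulN1r -RintegralZl //; last exact: measurable_angles.
by apply: eq_Rintegral => t _; rewrite Im_conjc mulN1r.
Qed.

Lemma circle_meanZ (c : R[i]) F : circle_integrable F ->
  circle_mean (fun z => c * F z) = c * circle_mean F.
Proof.
case: c => a b [F1 F2]; rewrite /circle_mean.
have mA := measurable_angles.
have i1 (x : R) : mu.-integrable angles (EFin \o (fun t => x * complex.Re (F (expi t)))).
  by apply: (integrableZl mA x F1).
have i2 (x : R) : mu.-integrable angles (EFin \o (fun t => x * complex.Im (F (expi t)))).
  by apply: (integrableZl mA x F2).
transitivity (((2 * pi)^-1 * \int[mu]_(t in angles)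
    (a * complex.Re (F (expi t)) - b * complex.Im (F (expi t)))) +i*
   ((2 * pi)^-1 * \int[mu]_(t in angles)
    (a * complex.Im (F (expi t)) + b * complex.Re (F (expi t))))).
  congr (_ * _ +i* (_ * _)); apply: eq_Rintegral => t _; first by rewrite Re_mulc.
  by rewrite Im_mulc.
rewrite RintegralB // RintegralD // !RintegralZl //.
set x := \int[_]_(_ in _) _; set y := \int[_]_(_ in _) _; set k := (_)^-1.
by apply/eqP; rewrite eq_complex /= -[_ == _]/(_ == _) /=; apply/andP; split;
  apply/eqP; ring.
Qed.

End CircleIntegrals.

(** * Means of polynomials over the circle and Parseval's identity *)

Section PolynomialMeans.
Variable R : realType.
Implicit Types (F G : R[i] -> R[i]) (p q : {poly R[i]}).

Local Notation mu := (@lebesgue_measure R).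
Local Notation angles := (@angles R : set (measurableTypeR R)).

Lemma horner_bounded p :
  exists2 M, 0 <= M & forall z : R[i], cabs z <= 1 -> cabs p.[z] <= M.
Proof.
elim/poly_ind: p => [|p c [M M0 pM]].
  by exists 0 => // z _; rewrite horner0 cabs0.
exists (M + cabs c); first by rewrite addr_ge0 ?cabs_ge0.
move=> z z1; rewrite !hornerE; apply: le_trans (cabsD _ _) _.
by rewrite lerD2r cabsM -[leRHS]mulr1 ler_pM ?cabs_ge0 ?pM.
Qed.

Lemma circle_integrable_bounded F M : circle_measurable F ->
  (forall t, cabs (F (expi t)) <= M) -> circle_integrable F.
Proof.
move=> mF FM; apply: (circle_integrable_le mF (integrable_cst_angles M)) => t _.
exact: FM.
Qed.

Lemma circle_integrable_poly p : circle_integrable (horner p).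
Proof.
have [M _ pM] := horner_bounded p.
apply: (circle_integrable_bounded (circle_measurable_poly p) (M := M)) => t.
by rewrite pM // cabs_expi.
Qed.

Lemma Rintegral_angles_derive (f g : R -> R) : continuous f ->
  (forall t : R, is_derive t 1 g (f t)) ->
  \int[mu]_(t in angles) f t = g (2 * pi) - g 0.
Proof.
move=> cf gf; rewrite /Rintegral /Defs.angles.
have cg : continuous g by move=> t; apply: differentiable_continuous; apply/derivable1_diffP.
rewrite (@continuous_FTC2 _ f g) //; first exact: pi2_gt0.
- exact: continuous_subspaceT.
- by split=> [t _||]; [| apply: cvg_at_right_filter; apply: cg
                       | apply: cvg_at_left_filter; apply: cg].
- by move=> t _; rewrite derive1E; apply: derive_val.
Qed.

Lemma circle_meanX k : circle_mean (fun z : R[i] => z ^+ k.+1) = 0.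
Proof.
pose m : R := k.+1%:R.
have m0 : m != 0 by rewrite pnatr_eq0.
(* That [m] is an integer enters here: [m * (2 * pi)] has cosine [1] and sine [0], so the primitives
   below agree at both ends of the interval. *)
have := expiX (2 * pi : R) k.+1; rewrite /expi mulrC mulr_natr cos2pi sin2pi expr1n.
rewrite -[pi *+ 2]mulr_natr -/m [pi * 2]mulrC => -[/esym c1 /esym s0].
rewrite /circle_mean; under [X in _ * X +i* _]eq_Rintegral do rewrite expiX -/m /=.
under [X in _ +i* (_ * X)]eq_Rintegral do rewrite expiX -/m /=.
clearbody m.
have Ic : \int[mu]_(t in angles) cos (m * t) = 0.
  have dg (t : R) : is_derive t (1 : R) (fun t : R => m^-1 * sin (m * t) : R) (cos (m * t)).
    apply: is_derive_eq; rewrite /GRing.scale /=; field.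
    exact: m0.
  rewrite (Rintegral_angles_derive _ dg) ?s0 ?mulr0 ?sin0 ?mulr0 ?subrr //.
  move=> t; apply: (@continuous_comp _ _ _ (fun t => m * t) cos).
    by apply: mulrl_continuous.
  exact: continuous_cos.
have Is : \int[mu]_(t in angles) sin (m * t) = 0.
  have dg (t : R) : is_derive t (1 : R) (fun t : R => - m^-1 * cos (m * t) : R) (sin (m * t)).
    apply: is_derive_eq; rewrite /GRing.scale /=; field.
    exact: m0.
  rewrite (Rintegral_angles_derive _ dg) ?c1 ?mulr0 ?cos0 ?subrr //.
  move=> t; apply: (@continuous_comp _ _ _ (fun t => m * t) sin).
    by apply: mulrl_continuous.
  exact: continuous_sin.
by rewrite Ic Is !mulr0.
Qed.

Lemma circle_mean_cst (c : R[i]) : circle_mean (fun=> c) = c.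
Proof.
have E (r : R) : \int[mu]_(t in angles) r = r * (2 * pi).
  rewrite Rintegral_cst; last exact: measurable_angles.
  by have /(congr1 fine) /= <- := mu_angles R.
rewrite /circle_mean !E; case: c => a b /=.
by congr (_ +i* _); rewrite mulrC mulfK // gt_eqF ?pi2_gt0.
Qed.

(** The mean value property at the origin. The exponent is kept general because peeling off the
    constant term of [p] raises it by one. *)
Lemma circle_meanX_poly p k : circle_mean (fun z => z ^+ k.+1 * p.[z]) = 0.
Proof.
elim/poly_ind: p k => [|p c IH] k.
  by under eq_fun do rewrite horner0 mulr0; apply: circle_mean_cst.
have -> : (fun z => z ^+ k.+1 * (p * 'X + c%:P).[z]) =
          (fun z => ('X^(k.+2) * p).[z] + (c%:P * 'X^(k.+1)).[z]).
  by apply/funext => z; rewrite !hornerE /= !exprS; ring.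
rewrite circle_meanD; try exact: circle_integrable_poly.
have -> : horner ('X^(k.+2) * p) = (fun z => z ^+ k.+2 * p.[z]).
  by apply/funext => z; rewrite hornerM hornerXn.
have -> : horner (c%:P * 'X^(k.+1)) = (fun z => c * z ^+ k.+1).
  by apply/funext => z; rewrite hornerM hornerXn hornerC.
rewrite IH add0r circle_meanZ ?circle_meanX ?mulr0 //.
by under eq_fun do rewrite -hornerXn; apply: circle_integrable_poly.
Qed.

Lemma conjcX (z : R[i]) n : conjc (z ^+ n) = conjc z ^+ n.
Proof. exact: rmorphXn. Qed.

Lemma circle_integrable_conjc F :
  circle_integrable F -> circle_integrable (fun z => conjc (F z)).
Proof.
move=> [F1 F2]; split; first by under eq_fun do rewrite Re_conjc.
have -> : EFin \o (fun t => complex.Im (conjc (F (expi t)))) =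
   (fun t => (-1)%:E * (EFin \o (fun t => complex.Im (F (expi t)))) t)%E.
  by apply/funext => t /=; rewrite Im_conjc -EFinM mulN1r.
exact: (integrableZl (@measurable_angles R) (-1) F2).
Qed.

(** Induction on the constant term: since [z conj z = 1] on the circle, pairing [p X] with [z^(n+1)]
    is pairing [p] with [z^n], and a constant is orthogonal to every positive power. *)
Lemma L2dot_poly p n : L2dot (horner p) (fun z => z ^+ n) = p`_n.
Proof.
elim/poly_ind: p n => [|p c IH] n.
  rewrite /L2dot coef0; under eq_fun do rewrite horner0 mul0r.
  exact: circle_mean_cst.
rewrite coefD coefMX coefC; case: n => [|n] /=.
  rewrite /L2dot add0r.
  transitivity (circle_mean (fun z => z ^+ 1 * p.[z] + c)).
    by congr circle_mean; apply/funext => z; rewrite expr0 conjc1 !hornerE mulrC.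
  rewrite circle_meanD ?circle_meanX_poly ?add0r ?circle_mean_cst //.
    have -> : (fun z => z ^+ 1 * p.[z]) = horner ('X * p).
      by apply/funext => z; rewrite !hornerE.
    exact: circle_integrable_poly.
  by apply: (circle_integrable_bounded (circle_measurable_cst c)) => t; apply: lexx.
rewrite addr0 -IH /L2dot.
have iX : circle_integrable (fun z : R[i] => conjc (z ^+ n.+1)).
  apply: circle_integrable_conjc.
  by under eq_fun do rewrite -hornerXn; apply: circle_integrable_poly.
transitivity (circle_mean (fun z => p.[z] * conjc (z ^+ n) + c * conjc (z ^+ n.+1))).
  apply: circle_mean_eq => t _; rewrite !hornerE.
  rewrite mulrDl; congr (_ + _).
  by rewrite exprS rmorphM /= -mulrA; congr (_ * _); rewrite mulrA expi_conjc mul1r.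
rewrite circle_meanD.
- rewrite circle_meanZ // circle_mean_conjc ?circle_meanX ?conjc0 ?mulr0 ?addr0 //.
  by under eq_fun do rewrite -hornerXn; apply: circle_integrable_poly.
- have [M _ pM] := horner_bounded p.
  apply: (circle_integrable_bounded (M := M)) => [|t].
    apply: circle_measurableM; first exact: circle_measurable_poly.
    apply: circle_measurable_conjc.
    by under eq_fun do rewrite -hornerXn; apply: circle_measurable_poly.
  by rewrite cabsM cabs_conjc cabsX cabs_expi expr1n mulr1 pM // cabs_expi.
- apply: (circle_integrable_bounded (M := cabs c)) => [|t].
    apply: circle_measurableM; first exact: circle_measurable_cst.
    apply: circle_measurable_conjc.
    by under eq_fun do rewrite -hornerXn; apply: circle_measurable_poly.
  by rewrite cabsM cabs_conjc cabsX cabs_expi expr1n mulr1.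
Qed.

(** On the circle [|z p + c|^2 = |p|^2 + |c|^2 + 2 Re (conj c z p)], and the last term has mean
    zero. The range [n] may exceed the size, so that summation lengths can be chosen freely. *)
Lemma parseval_mean p n : (size p <= n)%N ->
  circle_mean (fun z => p.[z] * conjc p.[z]) = (\sum_(i < n) cabs p`_i ^+ 2)%:C.
Proof.
elim/poly_ind: p n => [|p c IH] n.
  move=> _; under eq_fun do rewrite horner0 mul0r.
  rewrite circle_mean_cst big1 // => i _; by rewrite coef0 cabs0 expr0n.
case: n => [|n].
  rewrite leqn0 size_poly_eq0 => /eqP ->; rewrite big_ord0.
  by under eq_fun do rewrite horner0 mul0r; apply: circle_mean_cst.
rewrite size_MXaddC => pn; have {}pn : (size p <= n)%N.
  by case: ifP pn => // /andP[/eqP-> _] _; rewrite size_poly0.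
have mp := circle_measurable_poly p; have [M M0 pM] := horner_bounded p.
have mX : circle_measurable (fun z => z * p.[z]).
  by apply: circle_measurableM => //; apply: circle_measurable_id.
have i1 : circle_integrable (fun z => conjc c * (z * p.[z])).
  apply: (circle_integrable_bounded (M := cabs c * M)) => [|t].
    by apply: circle_measurableM => //; apply: circle_measurable_cst.
  by rewrite !cabsM cabs_conjc cabs_expi mul1r ler_wpM2l ?cabs_ge0 ?pM ?cabs_expi.
have i2 := circle_integrable_conjc i1.
have i3 : circle_integrable (fun z => p.[z] * conjc p.[z]).
  apply: (circle_integrable_bounded (M := M * M)) => [|t].
    by apply: circle_measurableM => //; apply: circle_measurable_conjc.
  by rewrite !cabsM cabs_conjc ler_pM ?cabs_ge0 ?pM ?cabs_expi.
have i4 : circle_integrable (fun=> c * conjc c).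
  apply: (circle_integrable_bounded (circle_measurable_cst _)) => t; exact: lexx.
transitivity (circle_mean (fun z => (p.[z] * conjc p.[z] + c * conjc c) +
   (conjc c * (z * p.[z]) + conjc (conjc c * (z * p.[z]))))).
  apply: circle_mean_eq => t _; move: (expi t) (expi_conjc t) => w ww; rewrite !hornerE.
  rewrite !(rmorphD, rmorphM) /= conjcK.
  transitivity (p.[w] * conjc p.[w] * (w * conjc w) + c * conjc c
    + conjc c * (w * p.[w]) + c * (conjc w * conjc p.[w])).
    by ring.
  by rewrite ww; ring.
have m0 : circle_mean (fun z => conjc c * (z * p.[z])) = 0.
  rewrite circle_meanZ; last first.
    have -> : (fun z => z * p.[z]) = horner ('X * p).
      by apply/funext => z; rewrite !hornerE.
    exact: circle_integrable_poly.
  have -> : (fun z => z * p.[z]) = (fun z => z ^+ 1 * p.[z]) by [].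
  by rewrite circle_meanX_poly mulr0.
rewrite circle_meanD; [|exact: circle_integrableD|exact: circle_integrableD].
rewrite circle_meanD // circle_meanD // circle_mean_conjc // m0 conjc0 !addr0.
rewrite (IH n) // circle_mean_cst big_ord_recl mul_conjc addrC -rmorphD /=.
congr (_ %:C); congr (_ + _).
  by rewrite coefD coefMX coefC /= add0r.
by apply: eq_bigr => i _; rewrite coefD coefMX coefC /= addr0.
Qed.

Lemma parseval p n : (size p <= n)%N ->
  (\int[mu]_(t in angles) (cabs p.[expi t] ^+ 2)%:E =
    (2 * pi * \sum_(i < n) cabs p`_i ^+ 2)%:E)%E.
Proof.
move=> pn; have := parseval_mean pn; rewrite /circle_mean => -[h _].
have pi0 := pi2_gt0 R.
have i3 : circle_integrable (fun z => p.[z] * conjc p.[z]).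
  have [M M0 pM] := horner_bounded p; have mp := circle_measurable_poly p.
  apply: (circle_integrable_bounded (M := M * M)) => [|t].
    by apply: circle_measurableM => //; apply: circle_measurable_conjc.
  by rewrite !cabsM cabs_conjc ler_pM ?cabs_ge0 ?pM ?cabs_expi.
have E : (fun t => complex.Re (p.[expi t] * conjc p.[expi t])) =
         (fun t => cabs p.[expi t] ^+ 2).
  by apply/funext => t; rewrite mul_conjc.
case: i3 => + _; rewrite E => i3.
rewrite -h E mulVKf ?gt_eqF // /Rintegral fineK //.
exact: (integrable_fin_num (@measurable_angles R) i3).
Qed.

End PolynomialMeans.

(** * Power series *)

Section PowerSeries.
Variable R : realType.
Implicit Types (f g : R[i] -> R[i]) (c d : nat -> R[i]) (p q : {poly R[i]}).

(** A bound on all partial sums carries an explicit constant through the constructions and passes to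
    coefficientwise limits. *)
Definition l2_bound c (S : R) := forall m, \sum_(n < m) cabs (c n) ^+ 2 <= S.

Definition taylor_disc c f := forall z : R[i], cabs z < 1 ->
  cabs (f z - (\poly_(n < m) c n).[z]) @[m --> \oo] --> (0 : R).

Lemma l2_bound_ge0 c S : l2_bound c S -> 0 <= S.
Proof. by move/(_ 0%N); rewrite big_ord0. Qed.

Lemma l2_bound_coef c S n : l2_bound c S -> cabs (c n) ^+ 2 <= S.
Proof.
move/(_ n.+1); apply: le_trans; rewrite big_ord_recr /= lerDr.
by apply: sumr_ge0 => i _; apply: sqr_ge0.
Qed.

Lemma l2_bound_cabs c S n : l2_bound c S -> cabs (c n) <= 1 + S.
Proof. by move/(l2_bound_coef n); have := sqr_ge0 (cabs (c n) - 2^-1); nra. Qed.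

Lemma H2P f : H2 f <-> analytic_disc f /\
  exists c S, l2_bound c S /\ taylor_disc c f.
Proof.
have E c z m : series (fun n => c n * z ^+ n) m = (\poly_(n < m) c n).[z] :> R[i].
  by rewrite horner_poly /series /= big_mkord.
split=> [[fa [c [cc fc]]]|[fa [c [S [cS fc]]]]]; split=> //.
- exists c, (limn (series (fun n => cabs (c n) ^+ 2))); split.
    move=> m; rewrite -(big_mkord xpredT (fun n => cabs (c n) ^+ 2)).
    apply: (nondecreasing_cvgn_le _ cc).
    by apply: nondecreasing_series => n _ _; apply: sqr_ge0.
  move=> z z1; have z1C : `|z| < 1 by rewrite normr_cabs (ltcR (cabs z) 1).
  have /cvg_cabsP := fc z z1C; apply: cvg_trans; apply: near_eq_cvg; near=> m.
  by rewrite cabsB; congr (cabs (_ - _)); apply: E.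
- exists c; split.
    apply: nondecreasing_is_cvgn.
      by apply: nondecreasing_series => n _ _; apply: sqr_ge0.
    by exists S => _ [m _ <-]; rewrite /series /= big_mkord.
  move=> z; rewrite normr_cabs (ltcR (cabs z) 1) => z1; apply/cvg_cabsP.
  have := fc z z1; apply: cvg_trans; apply: near_eq_cvg; near=> m.
  by rewrite cabsB; congr (cabs (_ - _)); apply/esym/E.
Unshelve. all: by end_near. Qed.

Lemma geometric_le (x : R) m n : 0 <= x < 1 ->
  \sum_(m <= i < n) x ^+ i <= x ^+ m / (1 - x).
Proof.
move=> /andP[x0 x1]; have x1' : 0 < 1 - x by rewrite subr_gt0.
have [nm|/ltnW mn] := leqP n m; first by rewrite big_geq // divr_ge0 ?exprn_ge0 // ltW.
rewrite ler_pdivlMr //; elim: n mn => [|n IH].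
  by rewrite leqn0 => /eqP ->; rewrite big_geq // mul0r.
rewrite leq_eqVlt => /predU1P[<-|]; first by rewrite big_geq // mul0r exprn_ge0.
rewrite ltnS => mn; rewrite big_nat_recr //= mulrDl.
suff : (\sum_(m <= i < n) x ^+ i) * (1 - x) = x ^+ m - x ^+ n.
  move=> ->; have := exprn_ge0 n.+1 x0; rewrite exprS; lra.
elim: n {IH} mn => [|n IH]; first by rewrite leqn0 => /eqP ->; rewrite big_geq // mul0r subrr.
rewrite leq_eqVlt => /predU1P[<-|]; first by rewrite big_geq // mul0r subrr.
by rewrite ltnS => mn; rewrite big_nat_recr //= mulrDl IH // exprS; ring.
Qed.

Lemma poly_sub_le c (C : R) (z : R[i]) m n : (forall n, cabs (c n) <= C) -> cabs z < 1 ->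
  (m <= n)%N ->
  cabs ((\poly_(i < n) c i).[z] - (\poly_(i < m) c i).[z]) <= C * (cabs z ^+ m / (1 - cabs z)).
Proof.
move=> cC z1 mn; rewrite !horner_poly.
rewrite -!(big_mkord xpredT (fun i => c i * z ^+ i)) (big_cat_nat (leq0n m) mn) //=.
rewrite addrAC subrr add0r; apply: le_trans (cabs_sum _ _ _) _.
apply: (@le_trans _ _ (C * \sum_(m <= i < n) cabs z ^+ i)); last first.
  by rewrite ler_wpM2l ?geometric_le ?cabs_ge0 //; exact: le_trans (cabs_ge0 _) (cC 0%N).
rewrite mulr_sumr; apply: ler_sum => i _; rewrite cabsM cabsX.
by rewrite ler_wpM2r // exprn_ge0 ?cabs_ge0.
Qed.

Lemma cvg_cabs_le (u : nat -> R[i]) (l : R[i]) (B : R) :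
  cabs (l - u n) @[n --> \oo] --> (0 : R) -> (\forall n \near \oo, cabs (u n) <= B) ->
  cabs l <= B.
Proof.
move=> ul uB; apply/ler_addgt0Pr => e e0.
have /cvgrPdist_lt /(_ e e0) := ul => he.
have [n [/= h1 h2]] : exists n, `|0 - cabs (l - u n)| < e /\ cabs (u n) <= B.
  by apply: (@filter_ex _ \oo); near=> n; split; near: n.
apply: le_trans (cabs_ltriangle l (u n)) _.
by rewrite lerD // ltW //; move: h1; rewrite sub0r normrN ger0_norm ?cabs_ge0.
Unshelve. all: by end_near. Qed.

Lemma taylor_tail c f (C : R) (z : R[i]) m : taylor_disc c f ->
  (forall n, cabs (c n) <= C) -> cabs z < 1 ->
  cabs (f z - (\poly_(i < m) c i).[z]) <= C * (cabs z ^+ m / (1 - cabs z)).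
Proof.
move=> fc cC z1.
apply: (@cvg_cabs_le (fun n => (\poly_(i < n) c i).[z] - (\poly_(i < m) c i).[z])).
  under eq_fun do rewrite opprB addrA subrK.
  exact: fc.
by exists m => // n /= mn; apply: poly_sub_le.
Qed.

(** Lagrange's argument: after symmetrising the double sum, each term of the difference is half of
    [(a_i b_j - a_j b_i)^2]. *)
Lemma cauchy_schwarz_sum n (a b : nat -> R) :
  (\sum_(i < n) a i * b i) ^+ 2 <= (\sum_(i < n) a i ^+ 2) * (\sum_(i < n) b i ^+ 2).
Proof.
rewrite expr2 !big_distrlr /=.
have E : \sum_(i < n) \sum_(j < n) a i ^+ 2 * b j ^+ 2 =
  \sum_(i < n) \sum_(j < n) (a i ^+ 2 * b j ^+ 2 + a j ^+ 2 * b i ^+ 2) / 2.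
  transitivity ((\sum_(i < n) \sum_(j < n) a i ^+ 2 * b j ^+ 2 +
     \sum_(i < n) \sum_(j < n) a j ^+ 2 * b i ^+ 2) / 2).
    rewrite [X in _ = (_ + X) / _]exchange_big /=; set X := \sum_(_ < _) _.
    by field.
  rewrite -big_split mulr_suml /=; apply: eq_bigr => i _.
  by rewrite -big_split mulr_suml.
rewrite E; apply: ler_sum => i _; apply: ler_sum => j _.
have := sqr_ge0 (a i * b j - a j * b i); nra.
Qed.

(** The reproducing kernel estimate of [H^2]: Cauchy-Schwarz for the coefficients against the powers
    of [z], whose squared moduli sum to at most [1 / (1 - |z|^2)]. *)
Lemma taylor_growth c f (S : R) (z : R[i]) : taylor_disc c f -> l2_bound c S ->
  cabs z < 1 -> cabs (f z) ^+ 2 * (1 - cabs z ^+ 2) <= S.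
Proof.
move=> fc cS z1; have S0 := l2_bound_ge0 cS; have z0 := cabs_ge0 z.
have d0 : 0 < 1 - cabs z ^+ 2 by rewrite subr_gt0 expr_lt1.
rewrite -ler_pdivlMr // -[leRHS]sqr_sqrtr ?divr_ge0 // ?(ltW d0) //.
rewrite ler_sqr ?nnegrE ?sqrtr_ge0 ?cabs_ge0 //.
apply: (cvg_cabs_le (fc _ z1)); near=> m.
rewrite -ler_sqr ?nnegrE ?sqrtr_ge0 ?cabs_ge0 // sqr_sqrtr ?divr_ge0 // ?(ltW d0) //.
rewrite horner_poly.
apply: (@le_trans _ _ ((\sum_(i < m) cabs (c i) * cabs z ^+ i) ^+ 2)).
  rewrite ler_sqr ?nnegrE ?cabs_ge0 //; last first.
    by apply: sumr_ge0 => i _; rewrite mulr_ge0 ?exprn_ge0 ?cabs_ge0.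
  by apply: le_trans (cabs_sum _ _ _) _; apply: ler_sum => i _; rewrite cabsM cabsX.
apply: le_trans (cauchy_schwarz_sum m (fun i => cabs (c i)) (fun i => cabs z ^+ i)) _.
apply: ler_pM => //; [by apply: sumr_ge0 => i _; apply: sqr_ge0| |].
  by apply: sumr_ge0 => i _; apply: sqr_ge0.
under eq_bigr do rewrite exprAC.
rewrite -(big_mkord xpredT (fun i => (cabs z ^+ 2) ^+ i)).
rewrite -[leRHS]mul1r -[X in X * _](expr0 (cabs z ^+ 2)); apply: geometric_le.
by rewrite sqr_ge0 expr_lt1.
Unshelve. all: by end_near. Qed.

Lemma taylorD c d f g : taylor_disc c f -> taylor_disc d g ->
  taylor_disc (fun n => c n + d n) (fun z => f z + g z).
Proof.
move=> fc gd z z1.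
have h : cabs (f z - (\poly_(n < m) c n).[z]) + cabs (g z - (\poly_(n < m) d n).[z])
    @[m --> \oo] --> (0 : R) by apply: cvg0_D; [apply: fc|apply: gd].
apply: (cvg0_le _ h); near=> m; rewrite cabs_ge0 /=.
apply: le_trans (cabsD _ _); rewrite le_eqVlt; apply/orP; left; apply/eqP.
congr cabs; rewrite !horner_poly addrACA -opprD -big_split /=; congr (_ - _).
by apply: eq_bigr => i _; rewrite mulrDl.
Unshelve. all: by end_near. Qed.

Lemma l2_boundD c d S S' : l2_bound c S -> l2_bound d S' ->
  l2_bound (fun n => c n + d n) (2 * S + 2 * S').
Proof.
move=> cS dS m.
apply: (@le_trans _ _ (\sum_(n < m) (2 * cabs (c n) ^+ 2 + 2 * cabs (d n) ^+ 2))).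
  apply: ler_sum => i _; have := cabsD (c i) (d i).
  have := cabs_ge0 (c i + d i); have := sqr_ge0 (cabs (c i) - cabs (d i)); nra.
rewrite big_split -!mulr_sumr /=.
by apply: lerD; rewrite ler_pM2l ?cS ?dS.
Qed.

Lemma taylorZ c f (a : R[i]) : taylor_disc c f ->
  taylor_disc (fun n => a * c n) (fun z => a * f z).
Proof.
move=> fc z z1; apply: cvg_trans (cvg0_Ml (cabs a) (fc z z1)); apply: near_eq_cvg; near=> m.
rewrite -cabsM mulrBr; congr (cabs (_ - _)); rewrite !horner_poly mulr_sumr.
by apply: eq_bigr => i _; rewrite mulrA.
Unshelve. all: by end_near. Qed.

Lemma l2_boundZ c S (a : R[i]) : l2_bound c S ->
  l2_bound (fun n => a * c n) (cabs a ^+ 2 * S).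
Proof.
move=> cS m; under eq_bigr do rewrite cabsM exprMn.
by rewrite -mulr_sumr ler_wpM2l // sqr_ge0.
Qed.

Definition shift_coef c n := if n is n'.+1 then c n' else 0.

Lemma taylorX c f : taylor_disc c f -> taylor_disc (shift_coef c) (fun z => z * f z).
Proof.
move=> fc z z1; rewrite -cvg_shiftS.
apply: cvg_trans (cvg0_Ml (cabs z) (fc z z1)); apply: near_eq_cvg; near=> m.
rewrite -cabsM mulrBr; congr (cabs (_ - _)); rewrite !horner_poly mulr_sumr.
rewrite big_ord_recl /= mul0r add0r; apply: eq_bigr => i _.
by rewrite /= exprS mulrCA.
Unshelve. all: by end_near. Qed.

Lemma l2_boundX c S : l2_bound c S -> l2_bound (shift_coef c) S.
Proof.
move=> cS [|m]; first by rewrite big_ord0 (l2_bound_ge0 cS).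
by rewrite big_ord_recl /= cabs0 expr0n add0r; apply: cS.
Qed.

Lemma taylor_poly p : taylor_disc (fun n => p`_n) (horner p).
Proof.
move=> z _; apply: cvg_near_cst; exists (size p) => // m /= pm.
apply/eqP; rewrite cabs_eq0 subr_eq0; apply/eqP; congr (_.[z]).
apply/polyP => i; rewrite coef_poly; case: ltnP => // mi.
by rewrite nth_default // (leq_trans pm).
Qed.

Lemma l2_bound_poly p : l2_bound (fun n => p`_n) (\sum_(n < size p) cabs p`_n ^+ 2).
Proof.
move=> m; rewrite -!(big_mkord xpredT (fun n => cabs p`_n ^+ 2)).
have [mp|pm] := leqP m (size p).
  by rewrite [leRHS](big_cat_nat (leq0n m) mp) //= lerDl; apply: sumr_ge0 => i _; apply: sqr_ge0.
rewrite (big_cat_nat (leq0n _) (ltnW pm)) //= [X in _ + X]big1_seq ?addr0 // => i.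
by rewrite mem_index_iota => /andP[_ /andP[pi _]]; rewrite nth_default // cabs0 expr0n.
Qed.

Lemma analytic_discD f g : analytic_disc f -> analytic_disc g ->
  analytic_disc (fun z => f z + g z).
Proof. by move=> fa ga z z1; apply: derivableD; [apply: fa|apply: ga]. Qed.

Lemma analytic_discM f g : analytic_disc f -> analytic_disc g ->
  analytic_disc (fun z => f z * g z).
Proof. by move=> fa ga z z1; apply: derivableM; [apply: fa|apply: ga]. Qed.

Lemma analytic_disc_poly p : analytic_disc (horner p).
Proof.
elim/poly_ind: p => [|p c IH].
  have -> : horner (0 : {poly R[i]}) = (fun=> 0) by apply/funext => z; rewrite horner0.
  by move=> z _; apply: derivable_cst.
have -> : horner (p * 'X + c%:P) = (fun z => p.[z] * z + c).
  by apply/funext => z; rewrite !hornerE.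
apply: analytic_discD; last by move=> z _; apply: derivable_cst.
apply: (@analytic_discM (horner p) id); [exact: IH | move=> z _].
exact: derivable_id.
Qed.

Lemma H2D f g : H2 f -> H2 g -> H2 (fun z => f z + g z).
Proof.
move=> /H2P[fa [c [S [cS fc]]]] /H2P[ga [d [S' [dS gd]]]]; apply/H2P; split.
  exact: analytic_discD.
by eexists; eexists; split; [apply: l2_boundD cS dS | apply: taylorD].
Qed.

Lemma H2_poly p : H2 (horner p).
Proof.
apply/H2P; split; first exact: analytic_disc_poly.
by eexists; eexists; split; [apply: l2_bound_poly | apply: taylor_poly].
Qed.

Lemma H2_polyM p f : H2 f -> H2 (fun z => p.[z] * f z).
Proof.
move=> /H2P[fa [c [S [cS fc]]]]; apply/H2P; split.
  by apply: analytic_discM; [apply: analytic_disc_poly|apply: fa].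
elim/poly_ind: p => [|p a [d [S' [dS' pd]]]].
  exists (fun n => 0 * c n), (cabs 0 ^+ 2 * S); split; first exact: l2_boundZ.
  by under [X in taylor_disc _ X]eq_fun do rewrite horner0; apply: taylorZ.
exists (fun n => shift_coef d n + a * c n), (2 * S' + 2 * (cabs a ^+ 2 * S)); split.
  by apply: l2_boundD; [apply: l2_boundX|apply: l2_boundZ].
have -> : (fun z => (p * 'X + a%:P).[z] * f z) = (fun z => z * (p.[z] * f z) + a * f z).
  by apply/funext => z; rewrite hornerMXaddC mulrDl mulrAC mulrC mulrA.
by apply: taylorD; [apply: taylorX|apply: taylorZ].
Qed.

Lemma taylor_polyX c f k : taylor_disc c f ->
  taylor_disc (fun n => if (n < k)%N then 0 else c (n - k)%N) (fun z => z ^+ k * f z).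
Proof.
move=> fc; elim: k => [|k IH].
  have -> : (fun n => if (n < 0)%N then 0 else c (n - 0)%N) = c.
    by apply/funext => n; rewrite subn0.
  have -> // : (fun z => z ^+ 0 * f z) = f by apply/funext => z; rewrite mul1r.
have -> : (fun z => z ^+ k.+1 * f z) = (fun z => z * (z ^+ k * f z)).
  by apply/funext => z; rewrite exprS mulrA.
have := taylorX IH; congr (taylor_disc _ _); apply/funext; by case.
Qed.

End PowerSeries.

(** * Radial boundary values *)

Section RadialApproximation.
Variable R : realType.
Implicit Types (f g F G : R[i] -> R[i]) (c d : nat -> R[i]) (p q : {poly R[i]}).

Local Notation mu := (@lebesgue_measure R).
Local Notation angles := (@angles R : set (measurableTypeR R)).

(** A sequence of radii rather than a continuous parameter, since Fatou's lemma is applied along it;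
    with [1 - 1/(k+1)] Bernoulli's inequality gives explicit rates. *)
Definition abel_radius (k : nat) : R := 1 - k.+1%:R^-1.

Lemma abel_radius_ge0 k : 0 <= abel_radius k.
Proof. by rewrite subr_ge0 invf_le1 ?ltr0n // ler1n. Qed.

Lemma abel_radius_lt1 k : abel_radius k < 1.
Proof. by rewrite ltrBlDr ltrDl invr_gt0 ltr0n. Qed.

Definition abel_weight (k n : nat) : R := if (n < k.+1 ^ 3)%N then abel_radius k ^+ n else 0.

(* The truncation length [(k+1)^3] makes the tail of a bounded-coefficient series
   at abel_radius [1 - 1/(k+1)] of size [O(1/(k+1))]. *)
Definition abel_poly c k : {poly R[i]} :=
  \poly_(n < (k.+1 ^ 3)%N) (c n * (abel_radius k ^+ n)%:C).

Lemma abel_polyE c k n : (abel_poly c k)`_n = c n * (abel_weight k n)%:C.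
Proof. by rewrite coef_poly /abel_weight; case: ifP => // _; rewrite mulr0. Qed.

(** Bernoulli's inequality; it keeps [abel_weight k n] within [n / (k+1)] of [1] for [n <= k]. *)
Lemma onemX_ge (x : R) n : 0 <= x <= 1 -> 1 - n%:R * x <= (1 - x) ^+ n.
Proof.
move=> /andP[x0 x1]; elim: n => [|n IH]; first by rewrite mul0r subr0 expr0.
rewrite exprS -natr1; apply: (@le_trans _ _ ((1 - x) * (1 - n%:R * x))).
  have : 0 <= n%:R * (x * x) by rewrite mulr_ge0 // mulr_ge0.
  by nra.
by rewrite ler_wpM2l // subr_ge0.
Qed.

(** The induction rests on [(1 - x) (1 + (n+1) x) <= 1 + n x]. At [x = 1/(k+1)] and exponent
    [(k+1)^3] it bounds the power by [1 / (k+1)^2], which survives the division by [1 - r = 1/(k+1)]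
    in a geometric tail. *)
Lemma onemX_le (x : R) n : 0 <= x <= 1 -> (1 - x) ^+ n * (1 + n%:R * x) <= 1.
Proof.
move=> /andP[x0 x1]; elim: n => [|n IH]; first by rewrite mul0r addr0 expr0 mulr1.
apply: le_trans IH; rewrite exprSr -mulrA ler_wpM2l ?exprn_ge0 ?subr_ge0 // -natr1.
have : 0 <= n%:R * (x * x) by rewrite mulr_ge0 // mulr_ge0.
by nra.
Qed.

Lemma abel_weight_ge0 k n : 0 <= abel_weight k n.
Proof. by rewrite /abel_weight; case: ifP => // _; rewrite exprn_ge0 ?abel_radius_ge0. Qed.

Lemma abel_weight_le1 k n : abel_weight k n <= 1.
Proof.
rewrite /abel_weight; case: ifP => // _.
by rewrite exprn_ile1 ?abel_radius_ge0 ?(ltW (abel_radius_lt1 k)).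
Qed.

Lemma abel_weight_ge k n : (n <= k)%N -> 1 - n%:R / k.+1%:R <= abel_weight k n.
Proof.
move=> nk; rewrite /abel_weight ifT; last first.
  by rewrite (leq_ltn_trans nk) // (leq_trans _ (leq_pexp2l (isT : 0 < k.+1) (isT : 1 <= 3)))%N ?expn1.
by apply: onemX_ge; rewrite invr_ge0 ler0n /= invf_le1 ?ltr0n // ler1n.
Qed.

Lemma natr_archi (x : R) : exists n : nat, x <= n%:R.
Proof.
exists (Num.Def.archi_bound `|x|); apply: ltW; apply: le_lt_trans (ler_norm x) _.
exact: archi_boundP.
Qed.

Lemma l2_tail c (S e : R) : l2_bound c S -> 0 < e ->
  exists n0, forall L, \sum_(n0 <= n < L) cabs (c n) ^+ 2 <= e.
Proof.
move=> cS e0; pose u m := \sum_(0 <= n < m) cabs (c n) ^+ 2.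
have un : {homo u : n m / (n <= m)%N >-> n <= m}.
  move=> n m nm; rewrite /u [leRHS](big_cat_nat (leq0n n) nm) /= lerDl.
  by apply: sumr_ge0 => i _; apply: sqr_ge0.
have ub : has_ubound (range u) by exists S => _ [m _ <-]; rewrite /u big_mkord.
have hs : has_sup (range u) by split => //; exists (u 0%N); exists 0%N.
have [_ [n0 _ <-] h] := sup_adherent e0 hs.
exists n0 => L; have [Ln|nL] := leqP L n0; first by rewrite big_geq // ltW.
have : u L <= sup (range u) by apply: ub_le_sup => //; exists L.
have -> : u L = u n0 + \sum_(n0 <= n < L) cabs (c n) ^+ 2.
  by rewrite /u (big_cat_nat (leq0n n0) (ltnW nL)).
by lra.
Qed.

(** Through Parseval, the Abel polynomials are Cauchy in [L^2] of the circle. Below [n0] both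
    weights are within [D] of [1]; from [n0] on, weights differ by at most [1] and the tail of [c]
    is small. *)
Lemma abel_poly_cauchy c (S e : R) : l2_bound c S -> 0 < e ->
  exists k0, forall k l L, (k0 <= k)%N -> (k0 <= l)%N ->
    \sum_(n < L) cabs ((abel_poly c k)`_n - (abel_poly c l)`_n) ^+ 2 <= e.
Proof.
move=> cS e0; have S0 := l2_bound_ge0 cS.
have e20 : 0 < e / 2 by rewrite divr_gt0.
have [n0 tl] := l2_tail cS e20.
(* [K >= S n0^2 / (e/2)] is enough although [D] is squared, because [(k0+1)^2 >= k0+1 >= K]. *)
have [K hK] := natr_archi (S * n0%:R ^+ 2 / (e / 2)).
set k0 := maxn n0 K; exists k0 => k l L hk hl.
pose D : R := n0%:R / k0.+1%:R.
have D0 : 0 <= D by rewrite divr_ge0.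
have k00 : 0 < k0.+1%:R :> R by rewrite ltr0n.
have SD : S * D ^+ 2 <= e / 2.
  move: hK; rewrite ler_pdivrMr // => hK.
  rewrite /D exprMn exprVn mulrA ler_pdivrMr ?exprn_gt0 //.
  apply: le_trans hK _; have Km : K%:R <= k0.+1%:R :> R.
    by rewrite ler_nat leqW // leq_maxr.
  have m1 : 1 <= k0.+1%:R :> R by rewrite ler1n.
  have K0 : 0 <= K%:R :> R by [].
  rewrite mulrC ler_wpM2l ?(ltW e20) //; nra.
have small m n : (k0 <= m)%N -> (n < n0)%N -> 1 - abel_weight m n <= D.
  move=> km nn; have nm : (n <= m)%N.
    by rewrite (leq_trans (ltnW nn)) // (leq_trans _ km) // leq_maxl.
  have hw := abel_weight_ge nm.
  suff hD : n%:R / m.+1%:R <= D.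
    by apply: le_trans hD; rewrite lerBlDl -lerBlDr.
  apply: ler_pM => //; first by rewrite ler_nat ltnW.
  by rewrite lef_pV2 ?posrE ?ltr0n // ler_nat ltnS.
have bnd n : (n < n0)%N -> (abel_weight k n - abel_weight l n) ^+ 2 <= D ^+ 2.
  move=> nn; have := small k n hk nn; have := small l n hl nn.
  have := abel_weight_le1 k n; have := abel_weight_le1 l n.
  move: (abel_weight k n) (abel_weight l n) => x y h1 h2 h3 h4; nra.
have bnd1 n : (abel_weight k n - abel_weight l n) ^+ 2 <= 1.
  have := abel_weight_ge0 k n; have := abel_weight_ge0 l n.
  have := abel_weight_le1 k n; have := abel_weight_le1 l n.
  move: (abel_weight k n) (abel_weight l n) => x y h1 h2 h3 h4; nra.
have E n : cabs ((abel_poly c k)`_n - (abel_poly c l)`_n) ^+ 2 =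
    cabs (c n) ^+ 2 * (abel_weight k n - abel_weight l n) ^+ 2.
  by rewrite !abel_polyE -mulrBr cabsM -rmorphB /= cabs_real exprMn real_normK ?num_real.
under eq_bigr do rewrite E.
pose v n := cabs (c n) ^+ 2 * (abel_weight k n - abel_weight l n) ^+ 2.
rewrite -(big_mkord xpredT v).
apply: (@le_trans _ _ (\sum_(0 <= n < n0) v n + \sum_(n0 <= n < L) v n)).
  have [Ln|nL] := leqP L n0; last by rewrite -big_cat_nat // ltnW.
  rewrite [X in _ + X]big_geq // addr0 [leRHS](big_cat_nat (leq0n _) Ln) /= lerDl.
  by apply: sumr_ge0 => i _; rewrite mulr_ge0 ?sqr_ge0.
rewrite [leRHS](splitr e); apply: lerD; last first.
  apply: le_trans (tl L); apply: ler_sum => i _.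
  by rewrite -[leRHS]mulr1 ler_wpM2l ?sqr_ge0.
apply: le_trans SD; rewrite big_mkord.
apply: (@le_trans _ _ (\sum_(n < n0) cabs (c n) ^+ 2 * D ^+ 2)).
  by apply: ler_sum => i _; rewrite ler_wpM2l ?sqr_ge0 ?bnd.
by rewrite -mulr_suml ler_wpM2r ?sqr_ge0.
Qed.

Lemma abel_poly_coef_cvg c n : (abel_poly c k)`_n @[k --> \oo] --> (c n : R[i]^o).
Proof.
apply/cvg_cabsP.
apply: (cvg0_le _ (cvg0_Ml (cabs (c n) * n%:R) (@cvg_harmonic R))).
exists n => // k /= nk; rewrite cabs_ge0 /= abel_polyE.
rewrite -{2}(mulr1 (c n)) -mulrBr cabsM -mulrA ler_wpM2l ?cabs_ge0 //.
rewrite -(rmorph1 (real_complex R)) -rmorphB /= cabs_real distrC ger0_norm ?subr_ge0 ?abel_weight_le1 //.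
by rewrite lerBlDl -lerBlDr; apply: abel_weight_ge.
Qed.

Lemma abel_radius_cvg : abel_radius k @[k --> \oo] --> (1 : R)^'-.
Proof.
move=> A [e /= e0 eA].
have [K hK] := natr_archi e^-1.
exists K => // k /= Kk; apply: eA; last exact: abel_radius_lt1.
rewrite /= /abel_radius opprB addrCA subrr addr0 ger0_norm ?invr_ge0 //.
rewrite invf_plt ?posrE ?ltr0n //; apply: le_lt_trans hK _.
by rewrite ltr_nat ltnS.
Qed.

(** At [w] the Abel polynomial is a partial sum of the Taylor series of [f] at the point
    [abel_radius k] times [w], so it differs from [f] there by a tail of order [1/(k+1)]; the radial
    limit does the rest. *)
Lemma abel_poly_cvg c f (S : R) (w l : R[i]) : taylor_disc c f -> l2_bound c S ->
  cabs w = 1 -> (f (r%:C * w) : R[i]^o) @[r --> (1 : R)^'-] --> (l : R[i]^o) ->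
  cabs ((abel_poly c k).[w] - l) @[k --> \oo] --> (0 : R).
Proof.
move=> fc cS w1 fl; set C := 1 + S.
have cC n : cabs (c n) <= C := l2_bound_cabs n cS.
have fk : cabs (f ((abel_radius k)%:C * w) - l) @[k --> \oo] --> (0 : R).
  move/cvg_cabsP : fl => fl; exact: cvg_comp abel_radius_cvg fl.
have h : C * harmonic k + cabs (f ((abel_radius k)%:C * w) - l) @[k --> \oo] --> (0 : R).
  by apply: cvg0_D => //; apply: cvg0_Ml; apply: cvg_harmonic.
apply: (cvg0_le _ h); near=> k; rewrite cabs_ge0 /=.
have rw : cabs ((abel_radius k)%:C * w) = abel_radius k.
  by rewrite cabsM cabs_real w1 mulr1 ger0_norm ?abel_radius_ge0.
have -> : (abel_poly c k).[w] = (\poly_(n < (k.+1 ^ 3)%N) c n).[(abel_radius k)%:C * w].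
  rewrite !horner_poly; apply: eq_bigr => i _.
  by rewrite exprMn -rmorphXn mulrA.
set z := _ * w in rw *; set P := _.[z].
apply: le_trans (cabs_ltriangle (P - l) (P - f z)) _.
have -> : P - l - (P - f z) = f z - l by ring.
rewrite lerD2r cabsB; apply: le_trans (taylor_tail _ fc cC _) _.
  by rewrite rw abel_radius_lt1.
rewrite rw ler_wpM2l ?(le_trans (cabs_ge0 _) (cC 0%N)) // /harmonic /=.
have k0 : 0 < k.+1%:R :> R by rewrite ltr0n.
have x01 : 0 <= (k.+1%:R^-1 : R) <= 1 by rewrite invr_ge0 ler0n /= invf_le1 // ler1n.
have := onemX_le (k.+1 ^ 3)%N x01; rewrite -/(abel_radius k).
have -> : 1 - abel_radius k = k.+1%:R^-1 by rewrite /abel_radius; ring.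
rewrite natrX; have -> : k.+1%:R ^+ 3 * k.+1%:R^-1 = k.+1%:R ^+ 2 :> R.
  by rewrite exprSr mulfK // gt_eqF.
move=> h1; rewrite invrK -[leRHS]mul1r ler_pdivlMr //; apply: le_trans h1; rewrite -mulrA.
apply: ler_wpM2l; first by rewrite exprn_ge0 ?abel_radius_ge0.
by rewrite -expr2 lerDr.
Unshelve. all: by end_near. Qed.

End RadialApproximation.

(** * Fatou's lemma and square integrability on the circle *)

Section BoundaryValues.
Variable R : realType.
Implicit Types (f g F G : R[i] -> R[i]) (c d : nat -> R[i]) (p q : {poly R[i]}).

Local Notation mu := (@lebesgue_measure R).
Local Notation angles := (@angles R : set (measurableTypeR R)).

(** Convergence almost everywhere lets [u] be replaced by the lower limit of the [v n], to which
    Fatou's lemma applies. *)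
Lemma fatou_le (v : nat -> R -> R) (u : R -> R) (K : R) :
  (forall n, measurable_fun angles (v n)) -> measurable_fun angles u ->
  (forall n t, 0 <= v n t) -> (forall t, 0 <= u t) ->
  {ae mu, forall t, angles t -> v n t @[n --> \oo] --> u t} ->
  (forall n, (\int[mu]_(t in angles) (v n t)%:E <= K%:E)%E) ->
  (\int[mu]_(t in angles) (u t)%:E <= K%:E)%E.
Proof.
move=> mv muu v0 u0 vu vK.
have mve n : measurable_fun angles (fun t => (v n t)%:E) by apply/measurable_EFinP.
apply: (@le_trans _ _ (\int[mu]_(t in angles) limn_einf (fun n => (v n t)%:E))%E).
  rewrite le_eqVlt; apply/orP; left; apply/eqP; apply: ae_eq_integral.
  - exact: measurable_angles.
  - exact/measurable_EFinP.
  - apply: measurableT_comp => //; apply: measurable_fun_limn_esup => n.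
    exact: measurableT_comp.
  - apply: filterS vu => t vut ta; apply/esym.
    have vuE : (v n t)%:E @[n --> \oo] --> (u t)%:E.
      by apply/fine_cvgP; split; [exact: nearW | exact: vut].
    by rewrite (cvg_limn_einf_sup vuE).1.
apply: le_trans (fatou mu _ _ _) _ => //; first exact: measurable_angles.
  by move=> n t _; rewrite lee_fin.
rewrite limn_einf_lim; apply: lime_le; first exact: is_cvg_einfs.
near=> n; apply: le_trans (vK n); apply: ereal_inf_lbound => /=.
by exists n => //=.
Unshelve. all: by end_near. Qed.

Lemma integrable_sqr_cabs F : circle_measurable F ->
  (\int[mu]_(t in angles) (cabs (F (expi t)) ^+ 2)%:E < +oo)%E ->
  mu.-integrable angles (EFin \o (fun t => cabs (F (expi t)) ^+ 2)).
Proof.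
move=> mF Foo; apply/integrableP; split.
  by apply/measurable_EFinP; apply: measurable_sqr_cabs.
rewrite (eq_integral (fun t : measurableTypeR R => (cabs (F (expi t)) ^+ 2)%:E)) // => t _.
by rewrite /= ger0_norm ?sqr_ge0.
Qed.

(** The inequality [|F| <= e/2 + |F|^2 / (2e)] has two balanced halves when the mean square is
    [e^2]. Estimating the real and imaginary parts separately costs the factor [2]. *)
Lemma circle_mean_small F (e : R) : circle_measurable F -> 0 < e ->
  (\int[mu]_(t in angles) (cabs (F (expi t)) ^+ 2)%:E <= (2 * pi * e ^+ 2)%:E)%E ->
  circle_integrable F /\ cabs (circle_mean F) <= 2 * e.
Proof.
move=> mF e0 Fe; have pi0 := pi2_gt0 R; have mA := @measurable_angles R.
have iF := integrable_sqr_cabs mF (le_lt_trans Fe (ltry _)).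
pose g t := 2^-1 * e + (2 * e)^-1 * cabs (F (expi t)) ^+ 2.
have ig2 : mu.-integrable angles (EFin \o (fun t => (2 * e)^-1 * cabs (F (expi t)) ^+ 2)).
  exact: (integrableZl mA (2 * e)^-1 iF).
have ig : mu.-integrable angles (EFin \o g).
  have -> : EFin \o g = (EFin \o cst (2^-1 * e)) \+
     (EFin \o (fun t => (2 * e)^-1 * cabs (F (expi t)) ^+ 2)) by [].
  by apply: (integrableD mA) => //; apply: integrable_cst_angles.
have Fg t : cabs (F (expi t)) <= g t.
  rewrite /g; move: (cabs _) => x.
  have -> : 2^-1 * e + (2 * e)^-1 * x ^+ 2 = x + (2 * e)^-1 * (x - e) ^+ 2.
    by field; rewrite gt_eqF.
  by rewrite lerDl mulr_ge0 ?sqr_ge0 // invr_ge0 mulr_ge0 // ltW.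
have iFF := circle_integrable_le mF ig (fun t _ => Fg t); split => //.
have Ig : \int[mu]_(t in angles) g t <= 2 * pi * e.
  rewrite /g RintegralD //; last exact: integrable_cst_angles.
  rewrite Rintegral_cst // RintegralZl //.
  have /(congr1 fine) /= -> := mu_angles R.
  have : \int[mu]_(t in angles) cabs (F (expi t)) ^+ 2 <= 2 * pi * e ^+ 2.
    by rewrite -lee_fin /Rintegral fineK //; apply: (integrable_fin_num mA iF).
  move: (\int[mu]_(t in angles) _) => x xe.
  have : (2 * e)^-1 * x <= (2 * e)^-1 * (2 * pi * e ^+ 2).
    by rewrite ler_wpM2l // invr_ge0 mulr_ge0 // ltW.
  have -> : (2 * e)^-1 * (2 * pi * e ^+ 2) = pi * e by field; rewrite gt_eqF.
  by lra.
have bnd (u : R -> R) : mu.-integrable angles (EFin \o u) ->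
    (forall t, `|u t| <= cabs (F (expi t))) ->
    `|(2 * pi)^-1 * \int[mu]_(t in angles) u t| <= e.
  move=> iu uF; rewrite normrM gtr0_norm ?invr_gt0 // ler_pdivrMl //.
  apply: le_trans (le_normr_Rintegral mA iu) _; apply: le_trans Ig.
  apply: le_Rintegral => //; first exact: (integrable_norm iu).
  by move=> t _; apply: le_trans (uF t) (Fg t).
have := cabs_le_ReIm (circle_mean F); rewrite /circle_mean /=.
have [i1 i2] := iFF.
have h1 := bnd _ i1 (fun t => Re_le_cabs (F (expi t))).
have h2 := bnd _ i2 (fun t => Im_le_cabs (F (expi t))).
by move=> /le_trans; apply; rewrite [leRHS]mulr_natl mulr2n lerD.
Qed.

Lemma circle_integrable_L2 F : circle_measurable F ->
  (\int[mu]_(t in angles) (cabs (F (expi t)) ^+ 2)%:E < +oo)%E -> circle_integrable F.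
Proof.
move=> mF Foo; have iF := integrable_sqr_cabs mF Foo.
have i1 : mu.-integrable angles (EFin \o (fun t => 1 + cabs (F (expi t)) ^+ 2)).
  have -> : EFin \o (fun t => 1 + cabs (F (expi t)) ^+ 2) = (EFin \o cst 1) \+
     (EFin \o (fun t => cabs (F (expi t)) ^+ 2)) by [].
  by apply: (integrableD (@measurable_angles R)) => //; apply: integrable_cst_angles.
apply: (circle_integrable_le mF i1) => t _.
by move: (cabs _) => x; have := sqr_ge0 (x - 2^-1); nra.
Qed.

(* [angles] carries two convertible measurable structures on the reals: the
   default one in [L2], and [measurableTypeR], the domain of [lebesgue_measure]. *)
Lemma L2P F : L2 F <-> circle_measurable F /\
  (\int[mu]_(t in angles) (cabs (F (expi t)) ^+ 2)%:E < +oo)%E.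
Proof. by split=> [[h1 h2 h3]|[[h1 h2] h3]]. Qed.

(* Cauchy-Schwarz is replaced by [|F G| <= |F|^2 + |G|^2]. *)
Lemma circle_integrableM F G : L2 F -> L2 G -> circle_integrable (fun z => F z * G z).
Proof.
move=> /L2P[mF Foo] /L2P[mG Goo].
have iF := integrable_sqr_cabs mF Foo; have iG := integrable_sqr_cabs mG Goo.
apply: (@circle_integrable_le _ _
  (fun t => cabs (F (expi t)) ^+ 2 + cabs (G (expi t)) ^+ 2)).
- exact: circle_measurableM.
- have -> : EFin \o (fun t => cabs (F (expi t)) ^+ 2 + cabs (G (expi t)) ^+ 2) =
     (EFin \o (fun t => cabs (F (expi t)) ^+ 2)) \+
     (EFin \o (fun t => cabs (G (expi t)) ^+ 2)) by [].
  exact: (integrableD (@measurable_angles R)).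
- move=> t _; rewrite cabsM.
  have := sqr_ge0 (cabs (F (expi t)) - cabs (G (expi t))).
  have := cabs_ge0 (F (expi t)); have := cabs_ge0 (G (expi t)); nra.
Qed.

Lemma L2_le F (g : R -> R) : circle_measurable F ->
  mu.-integrable angles (EFin \o g) ->
  (forall t, cabs (F (expi t)) ^+ 2 <= g t) -> L2 F.
Proof.
move=> mF ig Fg; apply/L2P; split => //.
have : mu.-integrable angles (EFin \o (fun t => cabs (F (expi t)) ^+ 2)).
  apply: (le_integrable (@measurable_angles R) _ _ ig).
    by apply/measurable_EFinP; apply: measurable_sqr_cabs.
  move=> t _; rewrite /= lee_fin ger0_norm ?sqr_ge0 //.
  by rewrite (le_trans (Fg t)) // ler_norm.
move=> /integrableP[_].
rewrite (eq_integral (fun t : measurableTypeR R => (cabs (F (expi t)) ^+ 2)%:E)) // => t _.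
by rewrite /= ger0_norm ?sqr_ge0.
Qed.

Lemma L2_bounded F M : circle_measurable F ->
  (forall t, cabs (F (expi t)) <= M) -> L2 F.
Proof.
move=> mF FM; apply: (L2_le mF (integrable_cst_angles (M ^+ 2))) => t /=.
by rewrite lerXn2r ?nnegrE ?cabs_ge0 // (le_trans (cabs_ge0 _) (FM 0)).
Qed.

Lemma L2_poly p : L2 (horner p).
Proof.
have [M _ pM] := horner_bounded p.
by apply: (L2_bounded (circle_measurable_poly p) (M := M)) => t; rewrite pM ?cabs_expi.
Qed.

Lemma L2D F G : L2 F -> L2 G -> L2 (fun z => F z + G z).
Proof.
move=> /L2P[mF Foo] /L2P[mG Goo].
have iF := integrable_sqr_cabs mF Foo; have iG := integrable_sqr_cabs mG Goo.
apply: (@L2_le _ (fun t => 2 * cabs (F (expi t)) ^+ 2 + 2 * cabs (G (expi t)) ^+ 2)).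
- exact: circle_measurableD.
- have mA := @measurable_angles R.
  exact: (integrableD mA (integrableZl mA 2 iF) (integrableZl mA 2 iG)).
- move=> t; have := cabsD (F (expi t)) (G (expi t)).
  have := cabs_ge0 (F (expi t) + G (expi t)).
  have := sqr_ge0 (cabs (F (expi t)) - cabs (G (expi t))); nra.
Qed.

Lemma L2_boundedM F G M : L2 F -> circle_measurable G ->
  (forall t, cabs (G (expi t)) <= M) -> L2 (fun z => G z * F z).
Proof.
move=> /L2P[mF Foo] mG GM; have iF := integrable_sqr_cabs mF Foo.
apply: (L2_le (circle_measurableM mG mF)
  (integrableZl (@measurable_angles R) (M ^+ 2) iF)) => t.
rewrite cabsM exprMn ler_wpM2r ?sqr_ge0 // lerXn2r ?nnegrE ?cabs_ge0 //.
exact: le_trans (cabs_ge0 _) (GM 0).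
Qed.

End BoundaryValues.

(** * Fourier coefficients of radial boundary values *)

Section FourierBoundary.
Variable R : realType.
Implicit Types (f g F G : R[i] -> R[i]) (c d : nat -> R[i]) (p q : {poly R[i]}).

Local Notation mu := (@lebesgue_measure R).
Local Notation angles := (@angles R : set (measurableTypeR R)).

Lemma ae_imp2 (P Q W : R -> Prop) : {ae mu, forall t, P t} -> {ae mu, forall t, Q t} ->
  (forall t, P t -> Q t -> W t) -> {ae mu, forall t, W t}.
Proof.
move=> aP aQ PQW.
exact: (@filterS2 _ _ (ae_filter_ringOfSetsType mu) P Q W PQW aP aQ).
Qed.

Lemma ae_imp (P W : R -> Prop) : {ae mu, forall t, P t} ->
  (forall t, P t -> W t) -> {ae mu, forall t, W t}.
Proof. by move=> aP PW; apply: (ae_imp2 aP aP) => t /PW. Qed.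

Lemma cabs_dist (z w : R[i]) : `|cabs z - cabs w| <= cabs (z - w).
Proof.
have := cabs_ltriangle z w; have := cabs_ltriangle w z.
by rewrite [cabs (w - z)]cabsB ler_norml => h1 h2; apply/andP; split; lra.
Qed.

Lemma cvg_cabs_sub (u : nat -> R[i]) (l y : R[i]) :
  cabs (u n - l) @[n --> \oo] --> (0 : R) ->
  cabs (u n - y) @[n --> \oo] --> cabs (l - y).
Proof.
move=> ul; apply/cvgrPdist_le => e e0; have /cvgrPdist_le /(_ e e0) := ul.
apply: filterS => n; rewrite sub0r normrN ger0_norm ?cabs_ge0 //; apply: le_trans.
rewrite distrC; apply: le_trans (cabs_dist _ _) _.
by rewrite le_eqVlt; apply/orP; left; apply/eqP; congr cabs; ring.
Qed.

Lemma near_left1 : \forall r \near (1 : R)^'-, 0 <= r < 1.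
Proof.
near=> r; apply/andP; split; last by near: r; apply: nbhs_left_lt.
by apply: ltW; near: r; apply: nbhs_left_gt; exact: ltr01.
Unshelve. all: by end_near. Qed.

Lemma radial_cvg (w : R[i]) : cabs w = 1 ->
  (r%:C * w : R[i]^o) @[r --> (1 : R)^'-] --> (w : R[i]^o).
Proof.
move=> w1; apply/cvg_cabsP.
have h : `|r - 1| @[r --> (1 : R)^'-] --> (0 : R).
  rewrite -(normr0 R) -[X in `|X|](subrr 1); apply: cvg_norm; apply: cvgB.
    exact/cvg_at_left_filter/cvg_id.
  exact: cvg_cst.
apply: (cvg0_le _ h); near=> r; rewrite cabs_ge0 /=.
by rewrite -{2}(mul1r w) -mulrBl cabsM w1 mulr1 -(rmorph1 (real_complex R)) -rmorphB cabs_real.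
Unshelve. all: by end_near. Qed.

Lemma boundary_valueD f g F G : boundary_value f F -> boundary_value g G ->
  boundary_value (fun z => f z + g z) (fun z => F z + G z).
Proof.
by move=> fF gG; apply: (ae_imp2 fF gG) => t {}fF {}gG ta; apply: cvgD; [apply: fF|apply: gG].
Qed.

Lemma boundary_valueM f g F G : boundary_value f F -> boundary_value g G ->
  boundary_value (fun z => f z * g z) (fun z => F z * G z).
Proof.
by move=> fF gG; apply: (ae_imp2 fF gG) => t {}fF {}gG ta; apply: cvgM; [apply: fF|apply: gG].
Qed.

Lemma boundary_value_poly p : boundary_value (horner p) (horner p).
Proof.
apply: aeW => t _; elim/poly_ind: p => [|p c IH].
  rewrite horner0; under eq_fun do rewrite horner0.
  exact: cvg_cst.
rewrite hornerMXaddC; under eq_fun do rewrite hornerMXaddC.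
apply: cvgD; last exact: cvg_cst.
by apply: cvgM; [exact: IH | apply: radial_cvg; rewrite cabs_expi].
Qed.

Lemma boundary_value_unique f F G : boundary_value f F -> boundary_value f G ->
  {ae mu, forall t, angles t -> F (expi t) = G (expi t)}.
Proof.
move=> fF fG; apply: (ae_imp2 fF fG) => t {}fF {}fG ta; apply/eqP; rewrite -subr_eq0 -cabs_eq0; apply/eqP.
move/cvg_cabsP: (fF ta) => h1; move/cvg_cabsP: (fG ta) => h2.
have h0 : cabs (F (expi t) - G (expi t)) @[r --> (1 : R)^'-] --> (0 : R).
  apply: (cvg0_le _ (cvg0_D h1 h2)); near=> r; rewrite cabs_ge0 /= [X in _ <= X + _]cabsB.
  set x := F _; set y := G _; set z := f _.
  by apply: le_trans (cabsD _ _); rewrite addrA subrK.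
by apply: (norm_cvg_unique _ h0); apply: cvg_cst.
Unshelve. all: by end_near. Qed.

Lemma boundary_value_eq_disc f g F : (forall z, cabs z < 1 -> f z = g z) ->
  boundary_value f F -> boundary_value g F.
Proof.
move=> fg fF; apply: (ae_imp fF) => t {}fF ta; apply: cvg_trans (fF ta).
apply: near_eq_cvg; near=> r; rewrite fg //.
rewrite cabsM cabs_expi mulr1 cabs_real.
have /andP[r0 r1] : 0 <= r < 1 by near: r; apply: near_left1.
by rewrite ger0_norm.
Unshelve. all: by end_near. Qed.

Lemma boundary_value_ae f F G : boundary_value f F ->
  {ae mu, forall t, angles t -> F (expi t) = G (expi t)} -> boundary_value f G.
Proof.
by move=> fF FG; apply: (ae_imp2 fF FG) => t {}fF {}FG ta; rewrite -FG //; apply: fF.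
Qed.

Lemma abel_poly_boundary c f S F : taylor_disc c f -> l2_bound c S -> boundary_value f F ->
  {ae mu, forall t, angles t ->
    cabs ((abel_poly c k).[expi t] - F (expi t)) @[k --> \oo] --> (0 : R)}.
Proof.
move=> fc cS fF; apply: (ae_imp fF) => t {}fF ta.
by apply: (abel_poly_cvg fc cS (cabs_expi t)); apply: fF.
Qed.

(** Fatou's lemma in one index of the Cauchy estimate: with [k] fixed, the mean square distance of
    [F] to the [k]-th polynomial is at most the lower limit of those between polynomials, which
    Parseval computes. *)
Lemma abel_poly_mean_cvg c f S F (e : R) : taylor_disc c f -> l2_bound c S ->
  circle_measurable F -> boundary_value f F -> 0 < e ->
  exists k0, forall k, (k0 <= k)%N ->
  (\int[mu]_(t in angles) (cabs (F (expi t) - (abel_poly c k).[expi t]) ^+ 2)%:E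
    <= (2 * pi * e)%:E)%E.
Proof.
move=> fc cS mF fF e0; have [k0 hk0] := abel_poly_cauchy cS e0.
exists k0 => k hk.
(* The shift by [k0] makes the Cauchy estimate hold for every index, as [fatou_le] asks, and not
   only for large ones. *)
apply: (@fatou_le _
  (fun n t => cabs ((abel_poly c (n + k0)).[expi t] - (abel_poly c k).[expi t]) ^+ 2)).
- move=> n; apply: (measurable_sqr_cabs (circle_measurableB
    (circle_measurable_poly (abel_poly c (n + k0))) (circle_measurable_poly (abel_poly c k)))).
- exact: (measurable_sqr_cabs (circle_measurableB mF (circle_measurable_poly _))).
- by move=> *; apply: sqr_ge0.
- by move=> *; apply: sqr_ge0.
- apply: (ae_imp (abel_poly_boundary fc cS fF)) => t h ta.
  have {}h := h ta; rewrite -(cvg_shiftn k0) in h.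
  by apply: cvgM; apply: (@cvg_cabs_sub (fun n => (abel_poly c (n + k0)).[expi t])).
- move=> n; under eq_integral do rewrite -hornerN -hornerD.
  rewrite (parseval (leqnn _)) lee_fin ler_pM2l ?pi2_gt0 //.
  under eq_bigr do rewrite coefB.
  by apply: hk0; rewrite ?leq_addl.
Qed.

(** An Abel polynomial [P] has the right Fourier coefficients in the limit, and replacing [F] by [P]
    changes a coefficient by the mean of [(F - P) conj z^n], which is small with the mean square of
    [F - P]. *)
Lemma fourier_boundary c f S F : taylor_disc c f -> l2_bound c S ->
  circle_measurable F -> boundary_value f F ->
  L2 F /\ forall n, L2dot F (fun z => z ^+ n) = c n.
Proof.
move=> fc cS mF fF; have mP k := circle_measurable_poly (abel_poly c k).
have L2F : L2 F.
  have [k0 /(_ k0 (leqnn _)) h] := abel_poly_mean_cvg fc cS mF fF ltr01.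
  have -> : F = (fun z => F z - (abel_poly c k0).[z] + (abel_poly c k0).[z]).
    by apply/funext => z; rewrite subrK.
  apply: L2D; last exact: L2_poly.
  apply/L2P; split; first exact: circle_measurableB.
  exact: le_lt_trans h (ltry _).
split=> // n; apply/eqP; rewrite -subr_eq0 -cabs_eq0; apply/eqP/le_anti.
rewrite cabs_ge0 andbT; apply/ler_addgt0Pl => e e0; rewrite addr0.
(* [circle_mean_small] doubles [e / 4], leaving [e / 2] for the coefficient of [P]. *)
have e40 : 0 < e / 4 by rewrite divr_gt0.
have [k0 hk0] := abel_poly_mean_cvg fc cS mF fF (exprn_gt0 2 e40).
have /cvg_cabsP /cvgrPdist_le /(_ (e / 2)) := @abel_poly_coef_cvg _ c n.
rewrite divr_gt0 // => /(_ isT)[k1 _ hk1].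
pose k := maxn k0 k1; pose P := abel_poly c k.
have {}hk0 := hk0 k (leq_maxl _ _); have {}hk1 := hk1 k (leq_maxr _ _).
rewrite sub0r normrN ger0_norm ?cabs_ge0 // -/P in hk1.
have mX : circle_measurable (fun z : R[i] => conjc (z ^+ n)).
  apply: circle_measurable_conjc.
  by under eq_fun do rewrite -hornerXn; apply: circle_measurable_poly.
have X1 (t : R) : cabs (conjc (expi t ^+ n)) = 1.
  by rewrite cabs_conjc cabsX cabs_expi expr1n.
have mFP : circle_measurable (fun z => (F z - P.[z]) * conjc (z ^+ n)).
  exact: (circle_measurableM (circle_measurableB mF (mP k)) mX).
have [iu su] : circle_integrable (fun z => (F z - P.[z]) * conjc (z ^+ n)) /\
    cabs (circle_mean (fun z => (F z - P.[z]) * conjc (z ^+ n))) <= 2 * (e / 4).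
  apply: circle_mean_small => //; under eq_integral do rewrite cabsM X1 mulr1.
  exact: hk0.
have E : L2dot F (fun z => z ^+ n) =
    circle_mean (fun z => (F z - P.[z]) * conjc (z ^+ n)) + P`_n.
  rewrite -L2dot_poly /L2dot -circle_meanD //.
    by congr circle_mean; apply/funext => z; rewrite -mulrDl subrK.
  apply: circle_integrableM; first exact: L2_poly.
  by apply: (L2_bounded (M := 1)) => // t; rewrite X1.
rewrite E -addrA; apply: le_trans (cabsD _ _) _; apply: le_trans (lerD su hk1) _.
by lra.
Qed.

(** [boundary_value] puts no measurability on [F], and in [coToeplitz] the boundary function of [f]
    has no other condition. The upper limit of the Abel polynomials is a measurable version of
    it. *)
Lemma measurable_boundary_value f F : H2 f -> boundary_value f F ->
  exists2 F', circle_measurable F' & boundary_value f F'.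
Proof.
move=> /H2P[_ [c [S [cS fc]]]] fF.
(* [fine] sends an infinite upper limit to [0]; within [angles] this can only happen on the null set
   where the polynomials fail to converge to [F]. *)
pose u (part : R[i] -> R) w := fine (limn_esup (fun k => (part (abel_poly c k).[w])%:E)).
pose F' w := u (@complex.Re R) w +i* u (@complex.Im R) w.
have mu_u part : (forall k, measurable_fun angles (fun t => part (abel_poly c k).[expi t])) ->
    measurable_fun angles (fun t => u part (expi t)).
  move=> h; apply: (measurableT_comp (fine_measurable _)) => //.
  by apply: measurable_fun_limn_esup => k; apply/measurable_EFinP.
exists F'.
  by split; apply: mu_u => k; have [] := circle_measurable_poly (abel_poly c k).
apply: (boundary_value_ae fF); apply: (ae_imp (abel_poly_boundary fc cS fF)) => t h ta.
have {}h := h ta.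
have part_cvg part : (forall z w, part (z - w) = part z - part w) ->
    (forall z, `|part z| <= cabs z) -> u part (expi t) = part (F (expi t)).
  move=> pB pc; have hp : part (abel_poly c k).[expi t] @[k --> \oo] --> part (F (expi t)).
    apply/cvgrPdist_le => e e0; have /cvgrPdist_le /(_ e e0) := h; apply: filterS => k.
    rewrite sub0r normrN ger0_norm ?cabs_ge0 //; apply: le_trans.
    by rewrite -pB cabsB pc.
  have hE : (part (abel_poly c k).[expi t])%:E @[k --> \oo] --> (part (F (expi t)))%:E.
    by apply/fine_cvgP; split; [exact: nearW | exact: hp].
  by rewrite /u (cvg_limn_einf_sup hE).2.
rewrite /F' !part_cvg; first by case: (F _).
- by move=> z w; rewrite Im_addc Im_oppc.
- exact: Im_le_cabs.
- by move=> z w; rewrite Re_addc Re_oppc.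
- exact: Re_le_cabs.
Qed.

End FourierBoundary.

(** * The range of the co-analytic Toeplitz operator *)

Section Range.
Variable R : realType.
Implicit Types (f g h F G H : R[i] -> R[i]) (c d : nat -> R[i]) (p q : {poly R[i]}).

Local Notation mu := (@lebesgue_measure R).
Local Notation angles := (@angles R : set (measurableTypeR R)).

Definition has_boundary_value f := exists F, boundary_value f F.

Lemma has_boundary_valueD f g : has_boundary_value f -> has_boundary_value g ->
  has_boundary_value (fun z => f z + g z).
Proof. by move=> [F fF] [G gG]; eexists; apply: boundary_valueD fF gG. Qed.

Lemma has_boundary_valueM f g : has_boundary_value f -> has_boundary_value g ->
  has_boundary_value (fun z => f z * g z).
Proof. by move=> [F fF] [G gG]; eexists; apply: boundary_valueM fF gG. Qed.

Lemma has_boundary_value_poly p : has_boundary_value (horner p).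
Proof. by eexists; apply: boundary_value_poly. Qed.

Lemma H2_measurable_boundary_value f : H2 f -> has_boundary_value f ->
  exists F, [/\ circle_measurable F, L2 F & boundary_value f F].
Proof.
move=> Hf [F0 fF0]; have [F mF fF] := measurable_boundary_value Hf fF0.
exists F; split => //; move/H2P : Hf => [_ [c [S [cS fc]]]].
by have [] := fourier_boundary fc cS mF fF.
Qed.

Lemma H2circle_poly p : H2circle (horner p).
Proof.
split; first exact: L2_poly.
by exists (horner p); [apply: H2_poly | apply: boundary_value_poly].
Qed.

Lemma taylor_unique c f g z : taylor_disc c f -> taylor_disc c g -> cabs z < 1 -> f z = g z.
Proof.
move=> fc gc z1; apply/eqP; rewrite -subr_eq0 -cabs_eq0; apply/eqP.
have h : cabs (f z - g z) @[m --> \oo] --> (0 : R).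
  apply: (cvg0_le _ (cvg0_D (fc z z1) (gc z z1))); near=> m; rewrite cabs_ge0 /=.
  rewrite [X in _ <= _ + X]cabsB; apply: le_trans (cabsD _ _).
  by rewrite addrA subrK.
by apply: (norm_cvg_unique _ h); apply: cvg_cst.
Unshelve. all: by end_near. Qed.

Section CirclePolynomial.
Variables (N : nat) (zeta : 'I_N -> R[i]).
Hypothesis zeta1 : forall j, cabs (zeta j) = 1.

Let a : {poly R[i]} := \prod_(j < N) ('X - (zeta j)%:P).
Let kappa : R[i] := \prod_(j < N) - conjc (zeta j).

(** Factor by factor: [conj (w - zeta) w = 1 - conj zeta w = - conj zeta (w - zeta)] when both have
    modulus one. *)
Lemma circle_poly_conjc w : cabs w = 1 -> conjc a.[w] * w ^+ N = kappa * a.[w].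
Proof.
move=> w1; rewrite /a /kappa horner_prod rmorph_prod /=.
rewrite -[in w ^+ N](card_ord N) -prodr_const -!big_split /=.
apply: eq_bigr => j _; rewrite hornerXsubC rmorphB /=.
have ww : w * conjc w = 1 by rewrite mul_conjc w1 expr1n.
have zz : zeta j * conjc (zeta j) = 1 by rewrite mul_conjc zeta1 expr1n.
transitivity (w * conjc w - conjc (zeta j) * w); first by ring.
by rewrite ww -zz; ring.
Qed.

Lemma circle_kappa_neq0 : kappa != 0.
Proof.
apply/prodf_neq0 => j _; rewrite oppr_eq0 conjc_eq0 -cabs_eq0 zeta1.
exact: oner_neq0.
Qed.

Lemma size_circle_poly : size a = N.+1.
Proof. by rewrite size_prod_XsubC -[index_enum _]enumT size_enum_ord. Qed.

Lemma circle_poly_neq0 : a != 0.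
Proof. by rewrite -size_poly_eq0 size_circle_poly. Qed.

Lemma coprime_Xn_circle_poly : coprimep 'X^N a.
Proof.
rewrite coprimep_expl // -['X]subr0 -polyC0 coprimep_sym coprimep_XsubC.
rewrite /root horner_prod; apply/prodf_neq0 => j _.
by rewrite hornerXsubC sub0r oppr_eq0 -cabs_eq0 zeta1 oner_neq0.
Qed.

Lemma range_decomposition g : coToeplitz_range (horner a) g ->
  [/\ H2 g, has_boundary_value g & exists h q,
    [/\ H2 h, has_boundary_value h, (size q <= N)%N &
        forall z, cabs z < 1 -> g z = a.[z] * h z + q.[z]]].
Proof.
move=> [f Hf [_ Hg [A [F [G [aA fF gG [L2U [L2G _] orth]]]]]]].
have [F' [mF' L2F' fF']] : exists F', [/\ circle_measurable F', L2 F' & boundary_value f F'].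
  by apply: H2_measurable_boundary_value => //; exists F.
have /H2P[_ [b [Sb [bS wb]]]] := H2_polyM (kappa%:P * a) Hf.
have wW := boundary_valueM (boundary_value_poly (kappa%:P * a)) fF'.
have mW := circle_measurableM (circle_measurable_poly (kappa%:P * a)) mF'.
have [L2W Wb] := fourier_boundary wb bS mW wW.
have /H2P[_ [d [Sd [dS gd]]]] := Hg.
have mG : circle_measurable G by move/L2P : L2G => [].
have [_ Gd] := fourier_boundary gd dS mG gG.
set U := fun z => conjc (A z) * F z in L2U orth.
have mU : circle_measurable U by move/L2P : L2U => [].
have UF : {ae mu, forall t, angles t -> expi t ^+ N * U (expi t) =
    (kappa%:P * a).[expi t] * F' (expi t)}.
  apply: (ae_imp2 (boundary_value_unique aA (boundary_value_poly a))
    (boundary_value_unique fF fF')) => t At Ft ta.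
  rewrite /U At // Ft // hornerM hornerC -circle_poly_conjc ?cabs_expi //; ring.
(* By orthogonality to [z^n], the coefficient [d n] is the [n]-th Fourier coefficient of [conj A F];
   multiplying by [z^N] moves it to index [n + N] of [kappa a F']. *)
have db n : d n = b (n + N)%N.
  rewrite -Gd -Wb.
  have L2X k : L2 (fun z : R[i] => conjc (z ^+ k)).
    apply: (L2_bounded (M := 1)).
      apply: circle_measurable_conjc; under eq_fun do rewrite -hornerXn.
      exact: circle_measurable_poly.
    by move=> t; rewrite cabs_conjc cabsX cabs_expi expr1n.
  have iU := circle_integrableM L2U (L2X n); have iG := circle_integrableM L2G (L2X n).
  transitivity (L2dot U (fun z => z ^+ n)).
    have := orth (horner 'X^n) (H2circle_poly _).
    have -> : L2dot (fun z => U z - G z) (horner 'X^n) =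
        circle_mean (fun z => U z * conjc (z ^+ n) + (-1) * (G z * conjc (z ^+ n))).
      by rewrite /L2dot; congr circle_mean; apply/funext => z; rewrite hornerXn; ring.
    rewrite circle_meanD // ?circle_meanZ //.
      by rewrite mulN1r => /eqP; rewrite subr_eq0 => /eqP e; rewrite /L2dot e.
    have mN1 : circle_measurable (fun=> - 1 : R[i]) by apply: circle_measurable_cst.
    have -> : (fun z => -1 * (G z * conjc (z ^+ n))) = (fun z => (-1 * G z) * conjc (z ^+ n)).
      by apply/funext => z; rewrite mulrA.
    apply: circle_integrableM => //; apply: (L2_boundedM (M := 1)) => // t.
    by rewrite cabsN cabs1.
  have mX k : circle_measurable (fun z : R[i] => conjc (z ^+ k)) by move/L2P: (L2X k) => [].
  apply: circle_mean_ae; [exact: circle_measurableM|exact: circle_measurableM|].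
  apply: (ae_imp UF) => t Ut ta; rewrite -Ut // exprD rmorphM /= !conjcX.
  transitivity (U (expi t) * conjc (expi t) ^+ n * (expi t * conjc (expi t)) ^+ N).
    by rewrite expi_conjc expr1n mulr1.
  by rewrite exprMn; ring.
pose p := \poly_(n < N) b n.
have gE z : cabs z < 1 -> z ^+ N * g z + p.[z] = (kappa%:P * a).[z] * f z.
  have := taylorD (taylor_polyX N gd) (taylor_poly p).
  have -> : (fun n => (if (n < N)%N then 0 else d (n - N)%N) + p`_n) = b.
    apply/funext => n; rewrite coef_poly; case: ltnP => nN; rewrite ?add0r ?addr0 //.
    by rewrite db subnK.
  by move=> h; apply: taylor_unique h wb.
split=> //; first by exists G.
have /Bezout_eq1_coprimepP[[u v] /= uv1] := coprime_Xn_circle_poly.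
(* From [u z^N + v a = 1] follows [g = u (z^N g + p) + v a g - u p = a (kappa u f + v g) - u p].
   Dividing [u p] by [a], of degree [N], moves the quotient into [h] and leaves a remainder of size
   at most [N]. *)
exists (fun z => (kappa%:P * u).[z] * f z + (v.[z] * g z + (- ((u * p) %/ a)).[z])).
exists (- ((u * p) %% a)); split.
- by apply: H2D; [apply: H2_polyM|apply: H2D; [apply: H2_polyM|apply: H2_poly]].
- apply: has_boundary_valueD.
    by apply: has_boundary_valueM; [apply: has_boundary_value_poly|exists F].
  apply: has_boundary_valueD; last exact: has_boundary_value_poly.
  by apply: has_boundary_valueM; [apply: has_boundary_value_poly|exists G].
- by rewrite size_polyN -ltnS -size_circle_poly ltn_modp circle_poly_neq0.
- move=> z z1; have e1 : u.[z] * z ^+ N + v.[z] * a.[z] = 1.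
    by rewrite -hornerXn -!hornerM -hornerD uv1 hornerC.
  have e2 : u.[z] * p.[z] = ((u * p) %/ a).[z] * a.[z] + ((u * p) %% a).[z].
    by rewrite -!hornerM -hornerD -divp_eq.
  have e3 := gE z z1; rewrite !hornerM hornerC in e3.
  rewrite !hornerM !hornerN hornerC.
  transitivity ((u.[z] * z ^+ N + v.[z] * a.[z]) * g z); first by rewrite e1 mul1r.
  transitivity (u.[z] * (z ^+ N * g z + p.[z]) + v.[z] * a.[z] * g z - u.[z] * p.[z]).
    by ring.
  by rewrite e3 e2; ring.
Qed.

Lemma range_intro g h q : analytic_disc g -> H2 h -> has_boundary_value h ->
  (forall z, cabs z < 1 -> g z = a.[z] * h z + q.[z]) ->
  coToeplitz_range (horner a) g.
Proof.
move=> ga Hh bh gE.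
have Hgsum : H2 (fun z => a.[z] * h z + q.[z]).
  by apply: H2D; [apply: H2_polyM|apply: H2_poly].
have Hg : H2 g.
  apply/H2P; split => //; move/H2P : Hgsum => [_ [c [S [cS fc]]]].
  exists c, S; split => // z z1; rewrite gE //; exact: fc.
have bg : has_boundary_value g.
  have [G gG] : has_boundary_value (fun z => a.[z] * h z + q.[z]).
    apply: has_boundary_valueD; last exact: has_boundary_value_poly.
    by apply: has_boundary_valueM => //; apply: has_boundary_value_poly.
  exists G; apply: boundary_value_eq_disc gG => z z1; exact/esym/gE.
pose s := ('X^N * q) %/ a; pose p := - (('X^N * q) %% a).
have sp : 'X^N * q + p = a * s.
  by rewrite /p {1}(divp_eq ('X^N * q) a) addrK mulrC.
have pN : (size p <= N)%N.
  by rewrite size_polyN -ltnS -size_circle_poly ltn_modp circle_poly_neq0.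
pose f z := (kappa^-1%:P * 'X^N).[z] * h z + (kappa^-1%:P * s).[z].
have Hf : H2 f by apply: H2D; [apply: H2_polyM|apply: H2_poly].
have bf : has_boundary_value f.
  apply: has_boundary_valueD; last exact: has_boundary_value_poly.
  by apply: has_boundary_valueM => //; apply: has_boundary_value_poly.
have fE z : cabs z < 1 -> (kappa%:P * a).[z] * f z = 'X^N.[z] * g z + p.[z].
  move=> z1; rewrite gE //.
  have : ('X^N * q + p).[z] = (a * s).[z] by rewrite sp.
  rewrite /f !(hornerM, hornerD, hornerC, hornerXn) => e.
  transitivity ((kappa * kappa^-1) * (a.[z] * (z ^+ N * h z) + a.[z] * s.[z])); first by ring.
  rewrite divff ?circle_kappa_neq0 // mul1r -e; ring.
have [F [mF L2F fF]] := H2_measurable_boundary_value Hf bf.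
have [G [mG L2G gG]] := H2_measurable_boundary_value Hg bg.
exists f; first exact: Hf.
split; [exact: Hf|exact: Hg|].
exists (horner a), F, G; split; [exact: boundary_value_poly|exact: fF|exact: gG|].
pose U z := conjc a.[z] * F z.
have [M _ aM] := horner_bounded a.
have mca : circle_measurable (fun z => conjc a.[z]).
  by apply: circle_measurable_conjc; apply: circle_measurable_poly.
have L2U : L2 U.
  by apply: (L2_boundedM (M := M)) => // t; rewrite cabs_conjc aM ?cabs_expi.
have mU : circle_measurable U by move/L2P: L2U => [].
split; [exact: L2U|split; [exact: L2G|exists g; [exact: Hg|exact: gG]]|].
move=> H [L2H [eta Heta etaH]].
have mH : circle_measurable H by move/L2P: L2H => [].
have UG : {ae mu, forall t, angles t ->
    U (expi t) - G (expi t) = conjc (expi t) ^+ N * p.[expi t]}.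
  have b1 := boundary_valueM (boundary_value_poly (kappa%:P * a)) fF.
  have b2 := boundary_valueD (boundary_valueM (boundary_value_poly 'X^N) gG)
    (boundary_value_poly p).
  have b3 := boundary_value_eq_disc fE b1.
  apply: (ae_imp (boundary_value_unique b3 b2)) => t h1 ta; have {h1} := h1 ta.
  rewrite hornerXn hornerM hornerC -circle_poly_conjc ?cabs_expi // => h1.
  have : conjc (expi t) ^+ N * (conjc a.[expi t] * expi t ^+ N * F (expi t)) =
         conjc (expi t) ^+ N * (expi t ^+ N * G (expi t) + p.[expi t]) by rewrite h1.
  have ee : conjc (expi t) ^+ N * expi t ^+ N = 1.
    by rewrite -exprMn mulrC expi_conjc expr1n.
  have -> : conjc (expi t) ^+ N * (conjc a.[expi t] * expi t ^+ N * F (expi t)) =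
    (conjc (expi t) ^+ N * expi t ^+ N) * U (expi t) by rewrite /U; ring.
  have -> : conjc (expi t) ^+ N * (expi t ^+ N * G (expi t) + p.[expi t]) =
    (conjc (expi t) ^+ N * expi t ^+ N) * G (expi t) + conjc (expi t) ^+ N * p.[expi t] by ring.
  by rewrite ee !mul1r => ->; rewrite addrC addKr.
(* On the circle [conj (U - G)] is the polynomial [z r(z)], so the pairing with
   [H] is the conjugate of the mean of a function vanishing at the origin. *)
pose r : {poly R[i]} := \sum_(k < N) (conjc p`_k)%:P * 'X^(N - k.+1).
have rE (w : R[i]) : w * conjc w = 1 -> w * r.[w] = conjc (conjc w ^+ N * p.[w]).
  move=> ww; rewrite (horner_coef_wide _ pN) /r horner_sum !mulr_sumr rmorph_sum /=.
  apply: eq_bigr => k _; rewrite hornerM hornerC hornerXn !(rmorphM, rmorphXn) /= conjcK.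
  have -> : w ^+ N = w * w ^+ (N - k.+1) * w ^+ k.
    by rewrite -exprS -exprD addSnnS subnK.
  transitivity (w * (conjc p`_k * w ^+ (N - k.+1)) * (w * conjc w) ^+ k).
    by rewrite ww expr1n mulr1.
  by rewrite exprMn; ring.
have /H2P[_ [d [Sd [dS yd]]]] := H2_polyM r Heta.
have yY : boundary_value (fun z => z * (r.[z] * eta z)) (fun z => z * (r.[z] * H z)).
  have bX : boundary_value (fun z : R[i] => z) (fun z => z).
    by have := boundary_value_poly ('X : {poly R[i]}); rewrite (_ : horner 'X = id) //;
      apply/funext => z; rewrite hornerX.
  exact: (boundary_valueM bX (boundary_valueM (boundary_value_poly r) etaH)).
have mY : circle_measurable (fun z => z * (r.[z] * H z)).
  exact: (circle_measurableM (@circle_measurable_id R)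
    (circle_measurableM (circle_measurable_poly r) mH)).
have [L2Y Y0] := fourier_boundary (taylorX yd) (l2_boundX dS) mY yY.
have iY : circle_integrable (fun z => z * (r.[z] * H z)).
  by move/L2P: L2Y => [_]; apply: circle_integrable_L2.
have {}Y0 : circle_mean (fun z => z * (r.[z] * H z)) = 0.
  have /= <- := Y0 0%N; rewrite /L2dot; congr circle_mean; apply/funext => z.
  by rewrite expr0 conjc1 mulr1.
transitivity (circle_mean (fun z => conjc (z * (r.[z] * H z)))); last first.
  by rewrite circle_mean_conjc // Y0 conjc0.
apply: circle_mean_ae.
- apply: circle_measurableM; last exact: circle_measurable_conjc.
  exact: circle_measurableB.
- exact: circle_measurable_conjc.
- apply: (ae_imp UG) => t h1 ta; rewrite (h1 ta) mulrA rE ?expi_conjc // rmorphM /= conjcK.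
  by [].
Qed.

End CirclePolynomial.
End Range.

(** * Bounded functions multiply the Hardy space into itself *)

Section BoundedMultiplication.
Variable R : realType.
Implicit Types (f g h phi : R[i] -> R[i]) (b c d : nat -> R[i]) (p q : {poly R[i]}).

Local Notation mu := (@lebesgue_measure R).
Local Notation angles := (@angles R : set (measurableTypeR R)).

Definition cauchy_product b c n := \sum_(i < n.+1) b i * c (n - i)%N.

Lemma cvg_exprn0 (x : R) : 0 <= x < 1 -> x ^+ n @[n --> \oo] --> (0 : R).
Proof. by move=> /andP[x0 x1]; apply: cvg_expr; rewrite ger0_norm. Qed.

Lemma coef_polyM_low b c m n : (n < m)%N ->
  ((\poly_(i < m) b i) * (\poly_(i < m) c i))`_n = cauchy_product b c n.
Proof.
move=> nm; rewrite coefM; apply: eq_bigr => i _; rewrite !coef_poly.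
have im : (i < m)%N by rewrite (leq_trans (ltn_ord i)).
by rewrite im (leq_ltn_trans (leq_subr i n) nm).
Qed.

Lemma horner_poly_le (u : nat -> R) (C x : R) m : 0 <= x < 1 ->
  (forall n, u n <= C) -> 0 <= C -> (\poly_(i < m) u i).[x] <= C / (1 - x).
Proof.
move=> x01 uC C0; have /andP[x0 x1] := x01; rewrite horner_poly.
apply: (@le_trans _ _ (C * \sum_(0 <= i < m) x ^+ i)).
  rewrite big_mkord mulr_sumr; apply: ler_sum => i _.
  by rewrite ler_wpM2r // exprn_ge0.
by rewrite ler_wpM2l // (le_trans (geometric_le _ _ x01)) // expr0 div1r.
Qed.

(** The product of the [m]-th partial sums agrees with the Cauchy product below index [m]; its
    higher coefficients are dominated by those of the product of the polynomials with coefficients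
    [|b_i|] and [|c_i|]. *)
Lemma taylorM b c f g S S' : taylor_disc b f -> taylor_disc c g ->
  l2_bound b S -> l2_bound c S' ->
  taylor_disc (cauchy_product b c) (fun z => f z * g z).
Proof.
move=> fb gc bS cS z z1; have z0 := cabs_ge0 z.
set C := 1 + S; set C' := 1 + S'.
have bC n : cabs (b n) <= C := l2_bound_cabs n bS.
have cC n : cabs (c n) <= C' := l2_bound_cabs n cS.
have C0 : 0 <= C := le_trans (cabs_ge0 _) (bC 0%N).
have C'0 : 0 <= C' := le_trans (cabs_ge0 _) (cC 0%N).
(* With [|z| = x^2], one factor [x^n <= x^m] gives the decay and the other keeps the majorant series
   convergent. *)
pose x := Num.sqrt (cabs z).
have x0 : 0 <= x by apply: sqrtr_ge0.
have x1 : x < 1.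
  rewrite -ltr_sqr ?nnegrE // expr1n /x sqr_sqrtr //.
have xx : cabs z = x * x by rewrite -expr2 /x sqr_sqrtr.
have x01 : 0 <= x < 1 by rewrite x0.
pose P m := \poly_(i < m) b i; pose Q m := \poly_(i < m) c i.
pose D m := \poly_(i < m) cauchy_product b c i.
have tail m : cabs ((P m * Q m).[z] - (D m).[z]) <= C / (1 - x) * (C' / (1 - x)) * x ^+ m.
  pose P' : {poly R} := \poly_(i < m) cabs (b i).
  pose Q' : {poly R} := \poly_(i < m) cabs (c i).
  pose L := maxn (size (P m * Q m)) (maxn (size (D m)) (size (P' * Q'))).
  rewrite -hornerN -hornerD (@horner_coef_wide _ L); last first.
    rewrite (leq_trans (size_polyD _ _)) // size_polyN geq_max leq_maxl /=.
    by rewrite !leq_max leqnn orbT.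
  apply: le_trans (cabs_sum _ _ _) _.
  apply: (@le_trans _ _ (\sum_(n < L) (P' * Q')`_n * x ^+ n * x ^+ m)).
    apply: ler_sum => n _; rewrite coefB cabsM cabsX xx exprMn.
    have PQ'0 : 0 <= (P' * Q')`_n.
      rewrite coefM; apply: sumr_ge0 => i _; rewrite !coef_poly.
      by apply: mulr_ge0; case: ifP => // _; rewrite cabs_ge0.
    have [nm|mn] := ltnP n m.
      rewrite coef_poly nm coef_polyM_low // subrr cabs0 mul0r.
      by rewrite !mulr_ge0 // exprn_ge0.
    rewrite [(D m)`_n]coef_poly ltnNge mn /= subr0 -mulrA.
    apply: ler_pM; rewrite ?cabs_ge0 ?mulr_ge0 ?exprn_ge0 //.
      rewrite !coefM; apply: le_trans (cabs_sum _ _ _) _; apply: ler_sum => i _.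
      by rewrite cabsM !coef_poly; apply: ler_pM; rewrite ?cabs_ge0 //;
        case: ifP => // _; rewrite cabs0.
    by rewrite ler_wpM2l ?exprn_ge0 // ler_wiXn2l // ltW.
  rewrite -mulr_suml ler_wpM2r ?exprn_ge0 //.
  rewrite -horner_coef_wide; last by rewrite !leq_max leqnn !orbT.
  rewrite hornerM; apply: ler_pM.
  - by rewrite horner_poly; apply: sumr_ge0 => i _; rewrite mulr_ge0 ?exprn_ge0 ?cabs_ge0.
  - by rewrite horner_poly; apply: sumr_ge0 => i _; rewrite mulr_ge0 ?exprn_ge0 ?cabs_ge0.
  - exact: horner_poly_le.
  - exact: horner_poly_le.
have zb m : cabs (P m).[z] <= C / (1 - cabs z).
  have := poly_sub_le bC z1 (leq0n m).
  by rewrite [X in _ - X.[z]]poly_def big_ord0 horner0 subr0 expr0 mulrA mulr1.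
apply: (cvg0_le _ (cvg0_D (cvg0_Ml (cabs (g z)) (fb z z1))
  (cvg0_D (cvg0_Ml (C / (1 - cabs z)) (gc z z1))
          (cvg0_Ml (C / (1 - x) * (C' / (1 - x))) (cvg_exprn0 x01))))).
near=> m; rewrite cabs_ge0 /=.
have -> : f z * g z - (D m).[z] = g z * (f z - (P m).[z]) +
   ((P m).[z] * (g z - (Q m).[z]) + ((P m * Q m).[z] - (D m).[z])).
  by rewrite hornerM; ring.
apply: le_trans (cabsD _ _) _; rewrite cabsM lerD2l.
apply: le_trans (cabsD _ _) _; apply: lerD; last exact: tail.
by rewrite cabsM ler_wpM2r ?cabs_ge0.
Unshelve. all: by end_near. Qed.

(** Parseval on both sides of [|p q|^2 <= M^2 |q|^2] on the circle; [K] is long enough to contain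
    the whole product. *)
Lemma poly_mul_coef_le p q (M : R) L : (forall w, cabs w = 1 -> cabs p.[w] <= M) ->
  (size q <= L)%N ->
  \sum_(n < L) cabs (p * q)`_n ^+ 2 <= M ^+ 2 * \sum_(n < L) cabs q`_n ^+ 2.
Proof.
move=> pM qL; pose K := (L + size (p * q)%R)%N.
have LK : (L <= K)%N by rewrite leq_addr.
apply: (@le_trans _ _ (\sum_(n < K) cabs (p * q)`_n ^+ 2)).
  rewrite -!(big_mkord xpredT (fun n => cabs (p * q)`_n ^+ 2)).
  rewrite [leRHS](big_cat_nat (leq0n _) LK) /= lerDl.
  by apply: sumr_ge0 => i _; apply: sqr_ge0.
rewrite -(@ler_pM2l _ (2 * pi)) ?pi2_gt0 // -lee_fin -parseval ?leq_addl //.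
rewrite mulrCA EFinM -parseval // -ge0_integralZl_EFin ?sqr_ge0 //.
- apply: ge0_le_integral.
  + exact: measurable_angles.
  + by move=> t _; rewrite lee_fin sqr_ge0.
  + apply/measurable_EFinP; exact: (measurable_sqr_cabs (circle_measurable_poly (p * q))).
  + apply: measurable_funeM.
    apply/measurable_EFinP; exact: (measurable_sqr_cabs (circle_measurable_poly q)).
  + move=> t _; rewrite -EFinM lee_fin hornerM cabsM exprMn ler_wpM2r ?sqr_ge0 //.
    rewrite lerXn2r ?nnegrE ?cabs_ge0 ?pM ?cabs_expi //.
    by rewrite (le_trans _ (pM 1 (cabs1 _))) ?cabs_ge0.
- exact: measurable_angles.
- by move=> t _; rewrite lee_fin sqr_ge0.
- apply/measurable_EFinP; exact: (measurable_sqr_cabs (circle_measurable_poly q)).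
Qed.

Lemma cvg_sum_ord (u : nat -> nat -> R) (l : nat -> R) L :
  (forall n, (n < L)%N -> u k n @[k --> \oo] --> l n) ->
  \sum_(n < L) u k n @[k --> \oo] --> \sum_(n < L) l n.
Proof.
elim: L => [|L IH] ul.
  by rewrite big_ord0; under eq_fun do rewrite big_ord0; apply: cvg_cst.
rewrite big_ord_recr /=; under eq_fun do rewrite big_ord_recr /=.
by apply: cvgD; [apply: IH => n nL; apply: ul; rewrite ltnS ltnW | apply: ul].
Qed.

(** On a dilated circle a long Taylor polynomial of [phi] is bounded by [M + 1], so
    [poly_mul_coef_le] bounds the first [L] coefficients of the product uniformly in the radius; the
    radius then tends to [1]. *)
Lemma H2_mul_bounded phi h (M : R) : (forall z, cabs z < 1 -> cabs (phi z) <= M) ->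
  H2 phi -> H2 h -> H2 (fun z => phi z * h z).
Proof.
move=> phiM /H2P[phia [b [S [bS pb]]]] /H2P[ha [c [S' [cS hc]]]]; apply/H2P; split.
  exact: analytic_discM.
exists (cauchy_product b c), ((M + 1) ^+ 2 * S'); split; last exact: taylorM pb hc bS cS.
have M0 : 0 <= M by rewrite (le_trans _ (phiM 0 _)) ?cabs_ge0 // cabs0.
(* [u k n] is the [n]-th coefficient of [phi(r z) h(z)] at [r = abel_radius R k]. Only [phi] is
   dilated: [h] enters through its first [L] coefficients alone. *)
move=> L; pose u k n := \sum_(i < n.+1) b i * (abel_radius R k ^+ i)%:C * c (n - i)%N.
have uL k : \sum_(n < L) cabs (u k n) ^+ 2 <= (M + 1) ^+ 2 * S'.
  set r := abel_radius R k; have r0 : 0 <= r := abel_radius_ge0 R k; have r1 : r < 1 := abel_radius_lt1 R k.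
  have r01 : 0 <= r < 1 by rewrite r0.
  set C := 1 + S; have bC n : cabs (b n) <= C := l2_bound_cabs n bS.
  have C0 : 0 <= C := le_trans (cabs_ge0 _) (bC 0%N).
  (* [m] is so large that truncating the dilated [phi] costs at most [1] on the circle, the [1] in
     [M + 1]; [L <= m] keeps the first [L] coefficients exact. *)
  have [m Lm Cm] : exists2 m, (L <= m)%N & C * (r ^+ m / (1 - r)) <= 1.
    have hC : C / (1 - r) * r ^+ m @[m --> \oo] --> (0 : R).
      by apply: cvg0_Ml; apply: cvg_exprn0.
    have /cvgrPdist_le /(_ 1 ltr01) [K _ hK] := hC.
    exists (maxn L K); first exact: leq_maxl.
    have := hK _ (leq_maxr L K); rewrite sub0r normrN => /(le_trans (ler_norm _)).
    by rewrite [r ^+ _ / _]mulrC mulrA.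
  pose P := \poly_(i < m) (b i * (r ^+ i)%:C); pose Q := \poly_(i < L) c i.
  have PM w : cabs w = 1 -> cabs P.[w] <= M + 1.
    move=> w1; have -> : P.[w] = (\poly_(i < m) b i).[r%:C * w].
      rewrite !horner_poly; apply: eq_bigr => i _.
      by rewrite exprMn -rmorphXn mulrA.
    have rw : cabs (r%:C * w) = r by rewrite cabsM cabs_real w1 mulr1 ger0_norm.
    have rw1 : cabs (r%:C * w) < 1 by rewrite rw.
    have := taylor_tail m pb bC rw1; rewrite rw cabsB => ht.
    apply: le_trans (cabs_ltriangle _ (phi (r%:C * w))) _.
    by apply: lerD; [apply: phiM | apply: le_trans Cm].
  have -> : \sum_(n < L) cabs (u k n) ^+ 2 = \sum_(n < L) cabs (P * Q)`_n ^+ 2.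
    apply: eq_bigr => n _; congr (cabs _ ^+ 2); rewrite /u coefM.
    apply: eq_bigr => i _; rewrite !coef_poly.
    have iL : (i < L)%N by rewrite (leq_trans (ltn_ord i)).
    by rewrite (leq_trans iL Lm) (leq_ltn_trans (leq_subr i n) (ltn_ord n)).
  apply: le_trans (poly_mul_coef_le PM (size_poly _ _)) _.
  rewrite ler_wpM2l ?sqr_ge0 //; apply: le_trans (cS L).
  by apply: ler_sum => n _; rewrite coef_poly ltn_ord.
have ud n : cabs (u k n - cauchy_product b c n) @[k --> \oo] --> (0 : R).
  pose K := \sum_(i < n.+1) cabs (b i) * i%:R * cabs (c (n - i)%N).
  apply: (cvg0_le _ (cvg0_Ml K (@cvg_harmonic R))); near=> k; rewrite cabs_ge0 /=.
  rewrite /u /cauchy_product -sumrB; apply: le_trans (cabs_sum _ _ _) _.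
  rewrite /K mulr_suml; apply: ler_sum => i _.
  rewrite -mulrBl -{2}(mulr1 (b i)) -mulrBr !cabsM -!mulrA ler_wpM2l ?cabs_ge0 //.
  rewrite [leRHS]mulrCA mulrC ler_wpM2l ?cabs_ge0 //.
  rewrite -(rmorph1 (real_complex R)) -rmorphB /= cabs_real distrC ger0_norm; last first.
    by rewrite subr_ge0 exprn_ile1 ?abel_radius_ge0 // ltW // abel_radius_lt1.
  rewrite lerBlDl -lerBlDr; apply: onemX_ge.
  by rewrite invr_ge0 ler0n /= invf_le1 ?ltr0n // ler1n.
have lim : \sum_(n < L) cabs (u k n) ^+ 2 @[k --> \oo] -->
    \sum_(n < L) cabs (cauchy_product b c n) ^+ 2.
  apply: (@cvg_sum_ord (fun k n => cabs (u k n) ^+ 2)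
    (fun n => cabs (cauchy_product b c n) ^+ 2)) => n _.
  have := cvg_cabs_sub (y := 0) (ud n); rewrite subr0.
  by under eq_fun do rewrite subr0; move=> hu; apply: cvgM.
by apply: (cvgr_to_le lim); near=> k; apply: uL.
Unshelve. all: by end_near. Qed.

End BoundedMultiplication.

(** * Bounded elements of the range, and vanishing at the zeros of [a] *)

Section RangeMultipliers.
Variable R : realType.
Implicit Types (f g h phi : R[i] -> R[i]) (p q : {poly R[i]}).
Variables (N : nat) (zeta : 'I_N -> R[i]).
Hypothesis zeta1 : forall j, cabs (zeta j) = 1.

Let a : {poly R[i]} := \prod_(j < N) ('X - (zeta j)%:P).

Lemma HinfP phi : Hinf phi -> exists M : R, forall z, cabs z < 1 -> cabs (phi z) <= M.
Proof.
move=> [_ [M phiM]]; exists (complex.Re M) => z z1.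
have z1C : `|z| < 1 by rewrite normr_cabs (ltcR (cabs z) 1).
by have := phiM z z1C; rewrite lecE => /andP[].
Qed.

Lemma bounded_range_multiplier phi f : coToeplitz_range (horner a) phi -> Hinf phi ->
  coToeplitz_range (horner a) f -> coToeplitz_range (horner a) (fun z => phi z * f z).
Proof.
move=> Mphi Iphi Mf; have [M phiM] := HinfP Iphi.
have [Hphi bphi [h1 [q1 [Hh1 bh1 _ phiE]]]] := range_decomposition zeta1 Mphi.
have [Hf bf [h0 [q0 [Hh0 bh0 _ fE]]]] := range_decomposition zeta1 Mf.
have fa : analytic_disc f by case: Hf.
apply: (@range_intro _ _ zeta zeta1 _
  (fun z => phi z * h0 z + q0.[z] * h1 z) (q1 * q0)).
- exact: analytic_discM Iphi.1 fa.
- by apply: H2D; [apply: H2_mul_bounded phiM Hphi Hh0 | apply: H2_polyM].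
- apply: has_boundary_valueD; apply: has_boundary_valueM; [exact: bphi|exact: bh0| |exact: bh1].
  exact: has_boundary_value_poly.
- move=> z z1; rewrite hornerM fE // mulrDr [phi z * q0.[z]](_ : _ = (a.[z] * h1 z + q1.[z]) * q0.[z]).
    by rewrite -/a; ring.
  by rewrite phiE.
Qed.

(** Along the radius to [w], the factor [(1 - r)^2] beats [|psi|^2 <= C / (1 - r)], so [q] vanishes
    at [w]. Cancelling [z - w] leaves [psi] unchanged, so the list [s] is consumed with repetitions
    and the size of [q] drops to zero. *)
Lemma radial_bound_poly_eq0 (s : seq R[i]) psi q :
  {in s, forall w, cabs w = 1} ->
  {in s, forall w, exists C : R, forall r : R, 0 <= r < 1 ->
     (1 - r) * cabs (psi (r%:C * w)) ^+ 2 <= C} ->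
  (size q <= size s)%N ->
  (forall z, cabs z < 1 -> q.[z] = (\prod_(w <- s) ('X - w%:P)).[z] * psi z) -> q = 0.
Proof.
elim: s q => [|w s IH] q s1 spsi; first by rewrite leqn0 size_poly_eq0 => /eqP.
move=> qs qE; have ws : w \in w :: s by rewrite mem_head.
have w1 := s1 w ws; have [C hC] := spsi w ws.
set b := \prod_(w <- s) ('X - w%:P).
have [M M0 bM] := horner_bounded b.
have C0 : 0 <= C.
  have := hC 0; rewrite lexx ltr01 => /(_ isT); apply: le_trans.
  by rewrite subr0 mul1r sqr_ge0.
have small (r : R) : 0 <= r < 1 -> cabs q.[r%:C * w] ^+ 2 <= M ^+ 2 * C * (1 - r).
  move=> /[dup] /hC hr /andP[r0 r1]; have r1' : 0 <= 1 - r by rewrite subr_ge0 ltW.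
  have rw : cabs (r%:C * w) = r by rewrite cabsM cabs_real w1 mulr1 ger0_norm.
  rewrite qE ?rw // big_cons -/b hornerM hornerXsubC !cabsM !exprMn.
  have -> : cabs (r%:C * w - w) = 1 - r.
    rewrite -{2}(mul1r w) -mulrBl cabsM w1 mulr1 -(rmorph1 (real_complex R)) -rmorphB.
    by rewrite /= cabs_real distrC ger0_norm.
  have h1 : cabs b.[r%:C * w] ^+ 2 <= M ^+ 2.
    by rewrite lerXn2r ?nnegrE ?cabs_ge0 // bM // rw ltW.
  have -> : (1 - r) ^+ 2 * cabs b.[r%:C * w] ^+ 2 * cabs (psi (r%:C * w)) ^+ 2 =
    cabs b.[r%:C * w] ^+ 2 * ((1 - r) * cabs (psi (r%:C * w)) ^+ 2) * (1 - r) by ring.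
  rewrite ler_wpM2r // ler_pM ?sqr_ge0 //.
  by rewrite mulr_ge0 ?sqr_ge0.
have qw : q.[w] = 0.
  have lim1 : cabs (q.[r%:C * w] - q.[w]) @[r --> (1 : R)^'-] --> (0 : R).
    apply/cvg_cabsP; elim/poly_ind: (q) => [|p c IHp].
      by rewrite horner0; under eq_fun do rewrite horner0; apply: cvg_cst.
    rewrite hornerMXaddC; under eq_fun do rewrite hornerMXaddC.
    apply: cvgD; last exact: cvg_cst.
    by apply: cvgM; [exact: IHp | apply: radial_cvg].
  have lim2 : cabs q.[r%:C * w] ^+ 2 @[r --> (1 : R)^'-] --> (0 : R).
    have h : 1 - r @[r --> (1 : R)^'-] --> (0 : R).
      rewrite -[X in _ --> X](subrr 1); apply: cvgB; first exact: cvg_cst.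
      exact/cvg_at_left_filter/cvg_id.
    apply: (cvg0_le _ (cvg0_Ml (M ^+ 2 * C) h)); near=> r.
    by rewrite sqr_ge0 /= small //; near: r; apply: near_left1.
  have lim3 : cabs q.[r%:C * w] @[r --> (1 : R)^'-] --> cabs q.[w].
    apply/cvgrPdist_le => e e0; have /cvgrPdist_le /(_ e e0) := lim1.
    apply: filterS => r; rewrite sub0r normrN ger0_norm ?cabs_ge0 //; apply: le_trans.
    by rewrite distrC; apply: cabs_dist.
  have lim4 : cabs q.[r%:C * w] ^+ 2 @[r --> (1 : R)^'-] --> cabs q.[w] ^+ 2.
    by apply: cvgM.
  have /eqP : cabs q.[w] ^+ 2 = 0 by apply: (norm_cvg_unique _ lim2); exact: lim4.
  by rewrite expf_eq0 /= cabs_eq0 => /eqP.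
have /factor_theorem [q1 q1E] : root q w by apply/rootP.
suff q10 : q1 = 0 by rewrite q1E q10 mul0r.
apply: IH.
- by move=> v vs; apply: s1; rewrite in_cons vs orbT.
- by move=> v vs; apply: spsi; rewrite in_cons vs orbT.
- have [->|q10] := eqVneq q1 0; first by rewrite size_poly0.
  by move: qs; rewrite q1E size_Mmonic ?monicXsubC // size_XsubC addn2.
- move=> z z1; have zw : z - w != 0.
    by rewrite subr_eq0; apply/eqP => zw; move: z1; rewrite zw w1 ltxx.
  apply: (mulIf zw); have := qE z z1; rewrite q1E big_cons -/b !hornerM !hornerXsubC => ->.
  by ring.
Unshelve. all: by end_near. Qed.

End RangeMultipliers.

(** * Test functions from sparse sums of kernels *)

Section GeometricSeries.
Variable R : realType.
Implicit Types (u v w : nat -> R[i]).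

(** Statements on infinite sums are checked on their partial sums of length [J], up to an error of
    order [2^-J]. *)
Lemma le_of_geometric (x B C : R) : (forall J : nat, x <= C * 2^-1 ^+ J + B) -> x <= B.
Proof.
move=> h; have lim : C * 2^-1 ^+ J + B @[J --> \oo] --> B.
  rewrite -[X in _ --> X]add0r; apply: cvgD; last exact: cvg_cst.
  by apply: cvg0_Ml; apply: cvg_exprn0; lra.
by apply: (cvgr_to_ge lim); near=> J; apply: h.
Unshelve. all: by end_near. Qed.

Lemma half_series_le (m n : nat) :
  \sum_(m <= j < n) 2^-1 ^+ j.+1 <= 2^-1 ^+ m :> R.
Proof.
have := @geometric_le R 2^-1 m n; set S := \sum_(_ <= _ < _) _; move=> h.
have -> : \sum_(m <= j < n) 2^-1 ^+ j.+1 = 2^-1 * S :> R.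
  by rewrite mulr_sumr; apply: eq_bigr => i _; rewrite exprS.
have : S <= 2^-1 ^+ m / (1 - 2^-1) by apply: h; lra.
have -> : 2^-1 ^+ m / (1 - 2^-1) = 2 * 2^-1 ^+ m :> R by field.
by lra.
Qed.

Lemma real_series_tail (v : nat -> R) (K : R) : (forall j, `|v j| <= K * 2^-1 ^+ j.+1) ->
  forall J, `|limn (fun n => \sum_(j < n) v j) - \sum_(j < J) v j| <= K * 2^-1 ^+ J.
Proof.
move=> vK J.
have K0 : 0 <= K.
  by have := le_trans (normr_ge0 _) (vK 0%N); rewrite pmulr_lge0 // exprn_gt0.
have part m n : (m <= n)%N -> `|\sum_(j < n) v j - \sum_(j < m) v j| <= K * 2^-1 ^+ m.
  move=> mn; rewrite -!(big_mkord xpredT v) (big_cat_nat (leq0n m) mn) /= addrAC subrr add0r.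
  apply: le_trans (ler_norm_sum _ _ _) _.
  apply: (@le_trans _ _ (K * \sum_(m <= j < n) 2^-1 ^+ j.+1)).
    by rewrite mulr_sumr; apply: ler_sum => j _; apply: vK.
  by rewrite ler_wpM2l // half_series_le.
have cv : cvgn (fun n => \sum_(j < n) v j).
  have -> : (fun n => \sum_(j < n) v j) = series v.
    by apply/funext => n; rewrite /series /= big_mkord.
  apply: normed_cvg; apply: nondecreasing_is_cvgn.
    by apply: nondecreasing_series => n _ _; apply: normr_ge0.
  exists K => _ [n _ <-]; rewrite /series /=.
  apply: (@le_trans _ _ (K * \sum_(0 <= j < n) 2^-1 ^+ j.+1)).
    by rewrite mulr_sumr; apply: ler_sum => j _; apply: vK.
  by rewrite -[leRHS]mulr1 ler_wpM2l // (le_trans (half_series_le _ _)) // expr0.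
have lim : `|\sum_(j < n) v j - \sum_(j < J) v j| @[n --> \oo] -->
    `|limn (fun n => \sum_(j < n) v j) - \sum_(j < J) v j|.
  by apply: cvg_norm; apply: cvgB => //; apply: cvg_cst.
by apply: (cvgr_to_le lim); exists J => // n /= Jn; apply: part.
Qed.

(** Total in [u]; [geometric_bound] makes both real limits exist, with an explicit rate. *)
Definition csum u : R[i] := limn (fun n => \sum_(j < n) complex.Re (u j)) +i*
  limn (fun n => \sum_(j < n) complex.Im (u j)).

Lemma Re_sum n u : complex.Re (\sum_(j < n) u j) = \sum_(j < n) complex.Re (u j).
Proof. by elim: n => [|n IH]; rewrite ?big_ord0 // !big_ord_recr /= Re_addc IH. Qed.

Lemma Im_sum n u : complex.Im (\sum_(j < n) u j) = \sum_(j < n) complex.Im (u j).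
Proof. by elim: n => [|n IH]; rewrite ?big_ord0 // !big_ord_recr /= Im_addc IH. Qed.

Definition geometric_bound (K : R) u := forall j, cabs (u j) <= K * 2^-1 ^+ j.+1.

Lemma csum_tail K u : geometric_bound K u ->
  forall J, cabs (csum u - \sum_(j < J) u j) <= 2 * K * 2^-1 ^+ J.
Proof.
move=> uK J; apply: le_trans (cabs_le_ReIm _) _.
rewrite Re_addc Im_addc Re_oppc Im_oppc Re_sum Im_sum /csum /=.
rewrite -mulrA [leRHS]mulr_natl mulr2n; apply: lerD.
- apply: (@real_series_tail (fun j => complex.Re (u j))) => j.
  exact: le_trans (Re_le_cabs _) (uK j).
- apply: (@real_series_tail (fun j => complex.Im (u j))) => j.
  exact: le_trans (Im_le_cabs _) (uK j).
Qed.

Lemma csum_bound K u : geometric_bound K u -> cabs (csum u) <= 2 * K.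
Proof. by move=> /csum_tail /(_ 0%N); rewrite big_ord0 subr0 mulr1. Qed.

Lemma geometric_boundD K K' u v : geometric_bound K u -> geometric_bound K' v ->
  geometric_bound (K + K') (fun j => u j + v j).
Proof. by move=> uK vK j; rewrite mulrDl; apply: le_trans (cabsD _ _) _; apply: lerD. Qed.

Lemma geometric_boundZ K (c : R[i]) u : geometric_bound K u ->
  geometric_bound (cabs c * K) (fun j => c * u j).
Proof. by move=> uK j; rewrite cabsM -mulrA ler_wpM2l ?cabs_ge0. Qed.

Lemma csumD K K' u v : geometric_bound K u -> geometric_bound K' v ->
  csum (fun j => u j + v j) = csum u + csum v.
Proof.
move=> uK vK; have uvK := geometric_boundD uK vK.
apply/eqP; rewrite -subr_eq0 -cabs_eq0; apply/eqP/le_anti; rewrite cabs_ge0 andbT.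
apply: (@le_of_geometric _ _ (4 * (K + K'))) => J; rewrite addr0.
have h1 := csum_tail uvK J; have h2 := csum_tail uK J; have h3 := csum_tail vK J.
set x := \sum_(j < J) u j in h2; set y := \sum_(j < J) v j in h3.
have xy : \sum_(j < J) (u j + v j) = x + y by rewrite big_split.
rewrite xy in h1.
have -> : csum (fun j => u j + v j) - (csum u + csum v) =
   (csum (fun j => u j + v j) - (x + y)) - ((csum u - x) + (csum v - y)) by ring.
apply: le_trans (cabsD _ _) _; rewrite cabsN.
have := cabsD (csum u - x) (csum v - y).
move: (2^-1 ^+ J) h1 h2 h3 => t; lra.
Qed.

Lemma csumZ K (c : R[i]) u : geometric_bound K u ->
  csum (fun j => c * u j) = c * csum u.
Proof.
move=> uK; have cuK := geometric_boundZ c uK.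
apply/eqP; rewrite -subr_eq0 -cabs_eq0; apply/eqP/le_anti; rewrite cabs_ge0 andbT.
apply: (@le_of_geometric _ _ (4 * (cabs c * K))) => J; rewrite addr0.
have h1 := csum_tail cuK J; have h2 := csum_tail uK J.
rewrite -mulr_sumr in h1; set x := \sum_(j < J) u j in h1 h2.
have -> : csum (fun j => c * u j) - c * csum u =
   (csum (fun j => c * u j) - c * x) - c * (csum u - x) by ring.
apply: le_trans (cabsD _ _) _; rewrite cabsN [cabs (c * (_ - _))]cabsM.
have := ler_wpM2l (cabs_ge0 c) h2.
move: (2^-1 ^+ J) h1 => t; lra.
Qed.

(** A quadratic remainder makes the difference quotient differ from [D] by at most [C |t|]. *)
Lemma derivable_quadratic (f : R[i] -> R[i]) (z D : R[i]) (C d : R) : 0 < d ->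
  (forall t, cabs t <= d -> cabs (f (z + t) - f z - t * D) <= C * cabs t ^+ 2) ->
  derivable (f : R[i]^o -> R[i]^o) z 1.
Proof.
move=> d0 fq; apply: (cvgP (D : R[i]^o)); apply/cvg_cabsP/cvgrPdist_le => e e0.
have C0 : 0 <= C.
  have := fq d%:C; rewrite cabs_real gtr0_norm // lexx => /(_ isT).
  by move=> /(le_trans (cabs_ge0 _)); rewrite pmulr_lge0 // exprn_gt0.
(* [C + 1] rather than [C], which may be [0]. *)
pose r := Num.min d (e / (C + 1)).
have C10 : 0 < C + 1 by rewrite ltr_wpDl.
have r0 : 0 < r by rewrite lt_min d0 divr_gt0.
have rC : (0 : R[i]) < r%:C by rewrite (ltcR 0 r).
near=> t.
have t0 : t != 0 by near: t; apply: nbhs_dnbhs_neq.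
have tr : cabs t < r.
  rewrite -lt_cabs; near: t; exact: dnbhs0_lt.
rewrite sub0r normrN ger0_norm ?cabs_ge0 //=.
have tc : 0 < cabs t by rewrite lt_def cabs_ge0 cabs_eq0 t0.
have td : cabs t <= d by move: tr; rewrite lt_min => /andP[/ltW].
have te : cabs t * (C + 1) <= e.
  by move: tr; rewrite lt_min => /andP[_ /ltW]; rewrite ler_pdivlMr.
have := fq t td; rewrite -(ler_pM2l tc) => h.
rewrite -(ler_pM2l tc) -(ler_pM2l tc) -!cabsM.
have -> : t * (t^-1 *: (f (t *: 1 + z) - f z) - D) = f (z + t) - f z - t * D.
  by rewrite /GRing.scale /= mulr1 [t + z]addrC mulrBr mulrA divff // mul1r.
rewrite cabsM; apply: le_trans h _.
rewrite ler_pM2l //; rewrite expr2 mulrCA ler_pM2l // mulrC.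
by apply: le_trans te; rewrite ler_pM2l // lerDl.
Unshelve. all: by end_near. Qed.

End GeometricSeries.

(** * The lacunary sum of kernels *)

Section TestFunction.
Variable R : realType.
Variable z : nat -> R[i].
Hypothesis z1 : forall j, cabs (z j) < 1.

(** [1 / s j] is the [H^2] norm of the kernel [k j], so [s j * k j] is the normalised reproducing
    kernel at [z j]. *)
Let s j : R := Num.sqrt (1 - cabs (z j) ^+ 2).
Let eta j : R := 2^-1 ^+ j.+1.
(* A square, so that Cauchy-Schwarz can split it in [kernel_l2_bound]. *)
Let eps j : R := eta j ^+ 2.
Let x j : R[i] := (eps j * s j)%:C.
Let k (j : nat) (v : R[i]) : R[i] := (1 - conjc (z j) * v)^-1.

Definition kernel_series (v : R[i]) : R[i] := csum (fun j => x j * k j v).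

Lemma kernel_radius_sqr j : s j ^+ 2 = 1 - cabs (z j) ^+ 2.
Proof. by rewrite sqr_sqrtr // subr_ge0 expr_le1 ?cabs_ge0 // ltW. Qed.

Lemma kernel_radius_ge0 j : 0 <= s j. Proof. exact: sqrtr_ge0. Qed.

Lemma kernel_radius_le1 j : s j <= 1.
Proof.
rewrite -(@expr_le1 _ 2) ?kernel_radius_ge0 // kernel_radius_sqr.
by have := sqr_ge0 (cabs (z j)); lra.
Qed.

Lemma eta_ge0 j : 0 <= eta j. Proof. by rewrite exprn_ge0. Qed.

Lemma eps_gt0 j : 0 < eps j. Proof. by rewrite !exprn_gt0. Qed.

Lemma eps_le_eta j : eps j <= eta j.
Proof.
rewrite /eps expr2 -[leRHS]mulr1 ler_wpM2l ?eta_ge0 // exprn_ile1 //; lra.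
Qed.

Lemma cabs_kernel_weight j : cabs (x j) <= eta j.
Proof.
rewrite /x cabs_real ger0_norm; last by rewrite mulr_ge0 ?(ltW (eps_gt0 j)) ?kernel_radius_ge0.
apply: le_trans (eps_le_eta j); rewrite -[leRHS]mulr1.
by rewrite ler_wpM2l ?kernel_radius_le1 // ltW // eps_gt0.
Qed.

Lemma kernel_geometric_bound (u : nat -> R[i]) (K : R) : (forall j, cabs (u j) <= K) ->
  geometric_bound K (fun j => x j * u j).
Proof.
move=> uK j; rewrite cabsM mulrC.
by apply: ler_pM; rewrite ?cabs_ge0 //; apply: cabs_kernel_weight.
Qed.

Lemma cabs_kernel (v : R[i]) (d : R) j : 0 < d -> d <= cabs (1 - conjc (z j) * v) ->
  cabs (k j v) <= d^-1.
Proof.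
by move=> d0 dv; rewrite /k cabsV lef_pV2 ?posrE // (lt_le_trans d0).
Qed.

Lemma disc_kernel_ge (v : R[i]) j : cabs v < 1 -> 1 - cabs v <= cabs (1 - conjc (z j) * v).
Proof.
move=> v1; have := cabs_ltriangle 1 (conjc (z j) * v); rewrite cabs1 cabsM cabs_conjc.
have : cabs (z j) * cabs v <= cabs v by rewrite ler_piMl ?cabs_ge0 // ltW.
by lra.
Qed.

(** The hypothesis also admits points of the circle, as boundary values require. For [|t| <= d/2]
    all denominators stay above [d/2], and termwise [k(v+t) - k(v) - t conj z_j k(v)^2 = t^2 conj
    z_j^2 k(v)^2 k(v+t)]. *)
Lemma kernel_series_derivable (v : R[i]) (d : R) : 0 < d ->
  (forall j, d <= cabs (1 - conjc (z j) * v)) ->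
  derivable (kernel_series : R[i]^o -> R[i]^o) v 1.
Proof.
move=> d0 dv; have d20 : 0 < d / 2 by rewrite divr_gt0.
apply: (@derivable_quadratic _ _ _ (csum (fun j => x j * (conjc (z j) * k j v ^+ 2)))
  (2 * (d^-1 ^+ 2 * (d / 2)^-1)) (d / 2)) => // t td.
have dvt j : d / 2 <= cabs (1 - conjc (z j) * (v + t)).
  have := cabs_ltriangle (1 - conjc (z j) * v) (1 - conjc (z j) * (v + t)).
  have -> : 1 - conjc (z j) * v - (1 - conjc (z j) * (v + t)) = conjc (z j) * t by ring.
  rewrite cabsM cabs_conjc; have := dv j.
  have : cabs (z j) * cabs t <= cabs t by rewrite ler_piMl ?cabs_ge0 // ltW.
  by lra.
have kv j := cabs_kernel d0 (dv j); have kvt j := cabs_kernel d20 (dvt j).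
have zle1 j : cabs (conjc (z j)) <= 1 by rewrite cabs_conjc ltW.
have b1 : geometric_bound (d / 2)^-1 (fun j => x j * k j (v + t)).
  exact: kernel_geometric_bound.
have b2 : geometric_bound d^-1 (fun j => x j * k j v).
  exact: kernel_geometric_bound.
have b3 : geometric_bound (d^-1 ^+ 2) (fun j => x j * (conjc (z j) * k j v ^+ 2)).
  apply: kernel_geometric_bound => j /=; rewrite cabsM cabsX -[leRHS]mul1r.
  by apply: ler_pM; rewrite ?exprn_ge0 ?cabs_ge0 // lerXn2r ?nnegrE ?cabs_ge0 ?invr_ge0 // ltW.
have b4 : geometric_bound (d^-1 ^+ 2 * (d / 2)^-1)
    (fun j => x j * (conjc (z j) ^+ 2 * k j v ^+ 2 * k j (v + t))).
  apply: kernel_geometric_bound => j /=; rewrite 2!cabsM !cabsX.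
  apply: ler_pM; rewrite ?mulr_ge0 ?exprn_ge0 ?cabs_ge0 // -[leRHS]mul1r.
  apply: ler_pM; rewrite ?exprn_ge0 ?cabs_ge0 // ?exprn_ile1 ?cabs_ge0 //.
  by rewrite lerXn2r ?nnegrE ?cabs_ge0 ?invr_ge0 // ltW.
have -> : kernel_series (v + t) - kernel_series v -
    t * csum (fun j => x j * (conjc (z j) * k j v ^+ 2)) =
    t ^+ 2 * csum (fun j => x j * (conjc (z j) ^+ 2 * k j v ^+ 2 * k j (v + t))).
  apply/eqP; rewrite !subr_eq; apply/eqP.
  rewrite -(csumZ _ b4) -(csumZ _ b3) -(csumD (geometric_boundZ _ b4) (geometric_boundZ _ b3)).
  rewrite /kernel_series -(csumD (geometric_boundD (geometric_boundZ (t ^+ 2) b4)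
    (geometric_boundZ t b3)) b2).
  congr csum; apply/funext => j; rewrite /k.
  have n1 : 1 - conjc (z j) * v != 0.
    by rewrite -cabs_eq0 gt_eqF // (lt_le_trans d0).
  have n2 : 1 - conjc (z j) * (v + t) != 0.
    by rewrite -cabs_eq0 gt_eqF // (lt_le_trans d20).
  by field; rewrite n1 n2.
rewrite cabsM cabsX mulrC ler_wpM2r ?exprn_ge0 ?cabs_ge0 //.
exact: csum_bound.
Qed.

Let c n : R[i] := csum (fun j => x j * conjc (z j) ^+ n).

Lemma kernel_coef_bound n : geometric_bound 1 (fun j => x j * conjc (z j) ^+ n).
Proof.
apply: kernel_geometric_bound => j /=.
by rewrite cabsX cabs_conjc exprn_ile1 ?cabs_ge0 // ltW.
Qed.

Lemma sum_eps_le J : \sum_(j < J) eps j <= 1 / 3.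
Proof.
have := @geometric_le R 4^-1 0 J; rewrite big_mkord.
have -> : \sum_(j < J) eps j = 4^-1 * \sum_(j < J) 4^-1 ^+ j.
  rewrite mulr_sumr; apply: eq_bigr => j _.
  by rewrite /eps /eta exprAC -exprS; congr (_ ^+ _); field.
rewrite expr0; have -> : 1 / (1 - 4^-1) = 4 / 3 :> R by field.
have -> : 0 <= (4^-1 : R) < 1 by apply/andP; split; lra.
by move=> /(_ isT); lra.
Qed.

(** Cauchy-Schwarz with weights [eta] bounds the squared [n]-th coefficient by the sum of
    [eps_j s_j^2 |z_j|^(2n)]. Summed over [n], the geometric series cancels [s_j^2], leaving the sum
    of the [eps_j]. *)
Lemma kernel_l2_bound : l2_bound c 1.
Proof.
move=> m.
pose cJ J n := \sum_(j < J) x j * conjc (z j) ^+ n.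
have lim : \sum_(n < m) cabs (cJ J n) ^+ 2 @[J --> \oo] --> \sum_(n < m) cabs (c n) ^+ 2.
  apply: (@cvg_sum_ord _ (fun J n => cabs (cJ J n) ^+ 2) (fun n => cabs (c n) ^+ 2)) => n _.
  have h : cabs (cJ J n - c n) @[J --> \oo] --> (0 : R).
    apply: (@cvg0_le R nat \oo _ _ (fun J => 2 * 2^-1 ^+ J)); last first.
      by apply: cvg0_Ml; apply: cvg_exprn0; lra.
    near=> J; rewrite cabs_ge0 cabsB /=.
    by have := csum_tail (kernel_coef_bound n) J; rewrite mulr1.
  have := cvg_cabs_sub (y := 0) h; rewrite subr0.
  by under eq_fun do rewrite subr0; move=> hu; apply: cvgM.
apply: (cvgr_to_le lim); near=> J.
apply: (@le_trans _ _ (\sum_(n < m) \sum_(j < J) eps j * (s j ^+ 2 * (cabs (z j) ^+ 2) ^+ n))).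
  apply: ler_sum => n _.
  apply: (@le_trans _ _ ((\sum_(j < J) eta j * (eta j * s j * cabs (z j) ^+ n)) ^+ 2)).
    rewrite lerXn2r ?nnegrE ?cabs_ge0 //.
      by apply: sumr_ge0 => j _; rewrite !mulr_ge0 ?eta_ge0 ?kernel_radius_ge0 ?exprn_ge0 ?cabs_ge0.
    apply: le_trans (cabs_sum _ _ _) _; apply: ler_sum => j _.
    rewrite cabsM cabsX cabs_conjc /x cabs_real ger0_norm.
      by rewrite /eps expr2 !mulrA.
    by rewrite mulr_ge0 ?kernel_radius_ge0 // ltW // eps_gt0.
  apply: le_trans (cauchy_schwarz_sum J eta (fun j => eta j * s j * cabs (z j) ^+ n)) _.
  rewrite -[leRHS]mul1r; apply: ler_pM.
  - by apply: sumr_ge0 => j _; apply: sqr_ge0.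
  - by apply: sumr_ge0 => j _; apply: sqr_ge0.
  - by have := sum_eps_le J; rewrite /eps; lra.
  - apply: ler_sum => j _; rewrite !exprMn -mulrA /eps exprAC.
    by rewrite lexx.
rewrite exchange_big /=.
apply: (@le_trans _ _ (\sum_(j < J) eps j)); last by have := sum_eps_le J; lra.
apply: ler_sum => j _; rewrite -mulr_sumr -[leRHS]mulr1 ler_wpM2l ?(ltW (eps_gt0 j)) //.
rewrite -mulr_sumr kernel_radius_sqr.
have y01 : 0 <= cabs (z j) ^+ 2 < 1 by rewrite sqr_ge0 expr_lt1 ?cabs_ge0 ?z1.
have := geometric_le 0 m y01; rewrite big_mkord expr0 ler_pdivlMr ?subr_gt0 //.
  by rewrite mulrC.
by case/andP: y01.
Unshelve. all: by end_near. Qed.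

Lemma kernel_taylor : taylor_disc c kernel_series.
Proof.
move=> v v1; have v0 := cabs_ge0 v; have dv : 0 < 1 - cabs v by rewrite subr_gt0.
have v01 : 0 <= cabs v < 1 by rewrite v0.
apply: (@cvg0_le R nat \oo _ _ (fun m => (1 - cabs v)^-1 * cabs v ^+ m)); last first.
  by apply: cvg0_Ml; apply: cvg_exprn0.
near=> m; rewrite cabs_ge0 /=.
have kv j := cabs_kernel dv (disc_kernel_ge j v1).
have b1 := kernel_geometric_bound kv.
(* With [m] fixed, the constant collects the errors of cutting the kernel sum at [J]: one for the
   value at [v], one for each of the [m] coefficients. *)
apply: (@le_of_geometric _ _ _ (2 * (1 - cabs v)^-1 + 2 * m%:R)) => J.
have t1 := csum_tail b1 J.
set PJ := \sum_(j < J) x j * k j v in t1.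
pose cJ n := \sum_(j < J) x j * conjc (z j) ^+ n.
have E : PJ - (\poly_(n < m) cJ n).[v] =
    \sum_(j < J) x j * ((conjc (z j) * v) ^+ m * k j v).
  rewrite horner_poly; under eq_bigr do rewrite mulr_suml.
  rewrite exchange_big -sumrB /=; apply: eq_bigr => j _.
  under eq_bigr do rewrite -mulrA -exprMn.
  rewrite -mulr_sumr -mulrBr; congr (_ * _).
  have n1 : 1 - conjc (z j) * v != 0.
    by rewrite -cabs_eq0 gt_eqF // (lt_le_trans dv) // disc_kernel_ge.
  apply: (mulIf n1); rewrite mulrBl -mulrA mulVf // mulr1.
  have := subrX1 (conjc (z j) * v) m; move: (conjc (z j) * v) => y.
  by move: (\sum_(i < m) y ^+ i) => w e; rewrite -[_ ^+ m](subrK 1) e; ring.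
have h2 : cabs (PJ - (\poly_(n < m) cJ n).[v]) <= (1 - cabs v)^-1 * cabs v ^+ m.
  rewrite E; apply: le_trans (cabs_sum _ _ _) _.
  apply: (@le_trans _ _ (\sum_(j < J) 2^-1 ^+ j.+1 * ((1 - cabs v)^-1 * cabs v ^+ m))).
    apply: ler_sum => j _; rewrite cabsM; apply: ler_pM; rewrite ?cabs_ge0 //.
      exact: cabs_kernel_weight.
    rewrite cabsM mulrC cabsX cabsM cabs_conjc exprMn.
    apply: ler_pM; rewrite ?cabs_ge0 ?mulr_ge0 ?exprn_ge0 ?cabs_ge0 //.
    by rewrite ler_piMl ?exprn_ge0 // exprn_ile1 ?cabs_ge0 // ltW.
  rewrite -mulr_suml ler_piMl ?mulr_ge0 ?exprn_ge0 ?invr_ge0 ?(ltW dv) //.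
  have := half_series_le R 0 J; rewrite big_mkord expr0; exact.
have h3 : cabs ((\poly_(n < m) cJ n).[v] - (\poly_(n < m) c n).[v]) <= 2 * m%:R * 2^-1 ^+ J.
  rewrite !horner_poly -sumrB; apply: le_trans (cabs_sum _ _ _) _.
  have -> : 2 * m%:R * 2^-1 ^+ J = \sum_(n < m) (2 * 2^-1 ^+ J) :> R.
    by rewrite sumr_const card_ord -[RHS]mulr_natr; ring.
  apply: ler_sum => n _; rewrite -mulrBl cabsM cabsX -[leRHS]mulr1.
  apply: ler_pM; rewrite ?exprn_ge0 ?cabs_ge0 //; last by rewrite exprn_ile1 ?cabs_ge0 // ltW.
  by rewrite cabsB; have := csum_tail (kernel_coef_bound n) J; rewrite mulr1.
have -> : kernel_series v - (\poly_(n < m) c n).[v] = (kernel_series v - PJ) +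
  ((PJ - (\poly_(n < m) cJ n).[v]) + ((\poly_(n < m) cJ n).[v] - (\poly_(n < m) c n).[v])).
  by ring.
apply: le_trans (cabsD _ _) _; apply: le_trans (lerD t1 (le_trans (cabsD _ _) (lerD h2 h3))) _.
by rewrite le_eqVlt; apply/orP; left; apply/eqP; ring.
Unshelve. all: by end_near. Qed.

Lemma kernel_series_H2 : H2 kernel_series.
Proof.
apply/H2P; split; last by exists c, 1; split; [apply: kernel_l2_bound|apply: kernel_taylor].
move=> v; rewrite normr_cabs (ltcR (cabs v) 1) => v1.
apply: (@kernel_series_derivable _ (1 - cabs v)); first by rewrite subr_gt0.
by move=> j; apply: disc_kernel_ge.
Qed.

(** The diagonal term contributes exactly [eps_j]. Sparsity bounds every other one by [eps_i eps_j]: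
    for [i < j] through [s_j], against [|1 - conj z_i z_j| >= 1 - |z_i|]; for [i > j] through [s_i].
    As the [eps_i] sum to at most [1/3], two thirds of [eps_j] remain. *)
Lemma kernel_series_ge j :
  (forall i l, (i < l)%N -> s l <= eps l * (1 - cabs (z i))) ->
  eps j / 2 <= cabs (kernel_series (z j)) * s j.
Proof.
move=> sparse; have zj := z1 j; have dv : 0 < 1 - cabs (z j) by rewrite subr_gt0.
have kv i := cabs_kernel dv (disc_kernel_ge i zj).
have b1 := kernel_geometric_bound kv.
have eps_anti i l : (i <= l)%N -> eps l <= eps i.
  move=> il; rewrite lerXn2r ?nnegrE ?eta_ge0 //.
  by rewrite ler_wiXn2l //; lra.
have off i : i != j -> cabs (x i * k i (z j)) * s j <= eps i * eps j.
  move=> ij; rewrite cabsM /x cabs_real ger0_norm; last first.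
    by rewrite mulr_ge0 ?kernel_radius_ge0 // ltW // eps_gt0.
  rewrite -2!(mulrA (eps i)) -(mulrA (s i)) ler_wpM2l ?(ltW (eps_gt0 i)) // /k cabsV.
  have [ji|ij'|/eqP] := ltngtP j i; last by rewrite eq_sym (negbTE ij).
  - apply: (@le_trans _ _ (eps i)); last by rewrite eps_anti // ltnW.
    have := sparse j i ji; rewrite -ler_pdivrMr // => sp; apply: le_trans sp.
    apply: ler_wpM2l; first exact: kernel_radius_ge0.
    rewrite -[leRHS]mulr1; apply: ler_pM; rewrite ?invr_ge0 ?cabs_ge0 ?kernel_radius_ge0 //.
      by rewrite -cabsV; apply: kv.
    exact: kernel_radius_le1.
  - have zi := z1 i; have di : 0 < 1 - cabs (z i) by rewrite subr_gt0.
    have := sparse i j ij'; rewrite -ler_pdivrMr // => sp; apply: le_trans sp.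
    rewrite mulrA [_ * s j]mulrC; apply: ler_wpM2l; first exact: kernel_radius_ge0.
    rewrite -[leRHS]mul1r; apply: ler_pM; rewrite ?invr_ge0 ?cabs_ge0 ?kernel_radius_ge0 //.
      exact: kernel_radius_le1.
    rewrite lef_pV2 ?posrE //; last first.
      by rewrite (lt_le_trans dv) // disc_kernel_ge.
    have := cabs_ltriangle 1 (conjc (z i) * z j); rewrite cabs1 cabsM cabs_conjc.
    have : cabs (z i) * cabs (z j) <= cabs (z i) by rewrite ler_piMr ?cabs_ge0 // ltW.
    by lra.
have diag : cabs (x j * k j (z j)) * s j = eps j.
  rewrite cabsM /x cabs_real ger0_norm; last first.
    by rewrite mulr_ge0 ?kernel_radius_ge0 // ltW // eps_gt0.
  rewrite /k mulrC [conjc _ * _]mulrC mul_conjc -(rmorph1 (real_complex R)) -rmorphB /=.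
  rewrite -kernel_radius_sqr cabsV cabs_real ger0_norm ?sqr_ge0 //.
  have s0 : s j != 0.
    by rewrite -sqrf_eq0 kernel_radius_sqr gt_eqF // subr_gt0 expr_lt1 ?cabs_ge0 ?z1.
  by field.
apply: (@le_of_geometric _ _ _ (2 * (1 - cabs (z j))^-1)) => J.
have [] : exists2 L, (J <= L)%N & (j < L)%N.
  by exists (maxn J j.+1); rewrite ?leq_maxl ?leq_maxr.
move=> L JL jL; have t1 := csum_tail b1 L.
rewrite (bigD1 (Ordinal jL)) //= in t1.
set Off := \sum_(i < L | _) _ in t1.
have hOff : cabs Off * s j <= eps j / 3.
  apply: (@le_trans _ _ (\sum_(i < L | i != Ordinal jL) eps i * eps j)).
    apply: (@le_trans _ _ (\sum_(i < L | i != Ordinal jL) cabs (x i * k i (z j)) * s j)).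
      by rewrite -mulr_suml ler_wpM2r ?kernel_radius_ge0 // cabs_sum.
    by apply: ler_sum => i ij; apply: off.
  rewrite -mulr_suml mulrC ler_wpM2l ?(ltW (eps_gt0 j)) //.
  apply: (@le_trans _ _ (\sum_(i < L) eps i)); last by have := sum_eps_le L; lra.
  by rewrite [leRHS](bigD1 (Ordinal jL)) //= lerDr ltW // eps_gt0.
have t2 : cabs (csum (fun i => x i * k i (z j)) - (x j * k j (z j) + Off)) * s j <=
    2 * (1 - cabs (z j))^-1 * 2^-1 ^+ J.
  apply: (@le_trans _ _ (2 * (1 - cabs (z j))^-1 * 2^-1 ^+ L)).
    rewrite -[leRHS]mulr1; apply: ler_pM; rewrite ?cabs_ge0 ?kernel_radius_ge0 //.
    exact: kernel_radius_le1.
  rewrite ler_wpM2l ?mulr_ge0 ?invr_ge0 ?(ltW dv) //.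
  by rewrite ler_wiXn2l //; lra.
have := cabs_ltriangle (x j * k j (z j))
   (csum (fun i => x i * k i (z j)) - (csum (fun i => x i * k i (z j)) - (x j * k j (z j) + Off)) - Off).
have -> : x j * k j (z j) - (csum (fun i => x i * k i (z j)) -
   (csum (fun i => x i * k i (z j)) - (x j * k j (z j) + Off)) - Off) = 0 by ring.
rewrite cabs0 addr0 => h.
have h' := le_trans h (le_trans (cabsD _ _) (lerD (cabsD _ _) (lexx _))).
rewrite !cabsN in h'; have := ler_wpM2r (kernel_radius_ge0 j) h'.
rewrite diag !mulrDl -/(kernel_series (z j)).
have := eps_gt0 j; lra.
Qed.

End TestFunction.

(** * Sequences along which an unbounded function grows *)

Section UnboundedFunctions.
Variable R : realType.
Implicit Types (phi : R[i] -> R[i]).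

(** Otherwise [phi] would be bounded on the disc near every point of the plane, and compactness of a
    square containing the disc would give one bound. *)
Lemma unbounded_cluster phi : ~ (exists M, forall z, cabs z < 1 -> cabs (phi z) <= M) ->
  exists w, forall B d : R, 0 < d ->
    exists z, [/\ cabs z < 1, cabs (z - w) < d & B < cabs (phi z)].
Proof.
apply: contra_notP => /forallNP nw.
have loc w : exists B d : R, 0 < d /\
    forall z, cabs z < 1 -> cabs (z - w) < d -> cabs (phi z) <= B.
  have /existsNP[B /existsNP[d /not_implyP[d0 nz]]] := nw w.
  exists B, d; split => // z z1 zw; rewrite leNgt; apply/negP => zB.
  by apply: nz; exists z.
have cK : compact (`[-1, 1]%classic `*` `[-1, 1]%classic : set (R * R)).
  by apply: compact_setX; apply: segment_compact.
pose P (M : R) (x : R * R) := cabs (x.1 +i* x.2) < 1 -> cabs (phi (x.1 +i* x.2)) <= M.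
have [M [_ hM]] : \forall M \near +oo, (`[-1, 1]%classic `*` `[-1, 1]%classic) `<=` P M.
  (* Near-covering with the bound [M] tending to infinity: a bound near each point, for all large
     [M], becomes one on the whole square. *)
  have nc := (compact_near_coveringP _).1 cK.
  apply: (nc R (pinfty_nbhs R) P) => -[x y] _.
  have [B [d [d0 Bd]]] := loc (x +i* y).
  have d20 : 0 < d / 2 by rewrite divr_gt0.
  near=> x' M => /= x'1; apply: (@le_trans _ _ B); last first.
    by near: M; apply: nbhs_pinfty_ge; rewrite num_real.
  apply: Bd => //; apply: le_lt_trans (cabs_le_ReIm _) _ => /=.
  rewrite (splitr d); apply: ltrD; rewrite distrC.
    by near: x'; exists (ball x (d / 2), setT) => /=; 
      [split; [exact: nbhsx_ballx | exact: filterT] | move=> [? ?] [] //].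
  by near: x'; exists (setT, ball y (d / 2)) => /=; 
    [split; [exact: filterT | exact: nbhsx_ballx] | move=> [? ?] [] //].
exists (M + 1) => -[x y] z1; apply: (hM (M + 1) _ (x, y)) => //.
  by rewrite ltrDl.
have h1 := le_lt_trans (Re_le_cabs _) z1; have h2 := le_lt_trans (Im_le_cabs _) z1.
by split; rewrite /= in_itv /=; [move: h1|move: h2]; rewrite ltr_norml => /andP[h3 h4];
  rewrite !ltW.
Unshelve. all: by end_near. Qed.

(** The growth bound forces points where [phi] is large to lie close to the circle, so asking for
    large values also yields sparsity. Each point depends on its predecessor only. *)
Lemma sparse_sequence phi (w : R[i]) (S : R) :
  (forall z, cabs z < 1 -> cabs (phi z) ^+ 2 * (1 - cabs z ^+ 2) <= S) ->
  (forall B d : R, 0 < d ->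
    exists z, [/\ cabs z < 1, cabs (z - w) < d & B < cabs (phi z)]) ->
  exists z : nat -> R[i], [/\ forall j, cabs (z j) < 1,
    forall j, cabs (z j - w) < j.+1%:R^-1,
    forall j, 8 ^+ j.+1 <= cabs (phi (z j)) &
    forall i l, (i < l)%N ->
      Num.sqrt (1 - cabs (z l) ^+ 2) <= (2^-1 ^+ l.+1) ^+ 2 * (1 - cabs (z i))].
Proof.
move=> phiS hw.
have S0 : 0 <= S.
  have := phiS 0; rewrite cabs0 ltr01 => /(_ isT); apply: le_trans.
  by rewrite expr0n /= subr0 mulr1 sqr_ge0.
have pickP (x : R * nat) : exists z, [/\ cabs z < 1, cabs (z - w) < x.2.+1%:R^-1 &
    x.1 < cabs (phi z)].
  by apply: hw; rewrite invr_gt0.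
have [pick hpick] := choice pickP.
pose eps (l : nat) : R := (2^-1 ^+ l.+1) ^+ 2.
have eps0 l : 0 < eps l by rewrite !exprn_gt0.
(* The first summand gives the growth, the second the sparsity: by [phiS], a value of at least
   [(1 + S) / E] forces [1 - |z|^2 <= E^2]. Writing [1 + S] keeps it positive when [S = 0]. *)
pose B v l : R := 8 ^+ l.+1 + (1 + S) / (eps l * (1 - cabs v)).
pose z := fix z j := if j is j'.+1 then pick (B (z j') j, j) else pick (8, 0%N).
have z1 j : cabs (z j) < 1.
  by case: j => [|j]; [have [] := hpick (8, 0%N) | have [] := hpick (B (z j) j.+1, j.+1)].
have zw j : cabs (z j - w) < j.+1%:R^-1.
  by case: j => [|j]; [have [] := hpick (8, 0%N) | have [] := hpick (B (z j) j.+1, j.+1)].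
have zB j : B (z j) j.+1 < cabs (phi (z j.+1)).
  by have [] := hpick (B (z j) j.+1, j.+1).
have Bpos j l : 0 < (1 + S) / (eps l * (1 - cabs (z j))).
  by rewrite divr_gt0 ?mulr_gt0 ?subr_gt0 // ltr_pwDl.
have z8 j : 8 ^+ j.+1 <= cabs (phi (z j)).
  case: j => [|j]; first by have [_ _ /ltW] := hpick (8, 0%N); rewrite expr1.
  by have := zB j; have := Bpos j j.+1; rewrite /B; lra.
have gap v : cabs v < 1 -> 0 <= 1 - cabs v ^+ 2.
  by move=> v1; rewrite subr_ge0 expr_le1 ?cabs_ge0 // ltW.
have step j : Num.sqrt (1 - cabs (z j.+1) ^+ 2) <= eps j.+1 * (1 - cabs (z j)).
  set E := eps j.+1 * (1 - cabs (z j)).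
  have E0 : 0 < E by rewrite mulr_gt0 ?subr_gt0.
  rewrite -ler_sqr ?nnegrE ?sqrtr_ge0 ?(ltW E0) // sqr_sqrtr ?gap //.
  have phiE : (1 + S) / E <= cabs (phi (z j.+1)).
    have := zB j; have : 0 < 8 ^+ j.+2 :> R by rewrite exprn_gt0.
    by rewrite /B -/E; lra.
  have := phiS _ (z1 j.+1); set X := cabs (phi _) in phiE *; set Y := 1 - _ => XY.
  have SE : 0 < (1 + S) / E by rewrite divr_gt0 // ltr_pwDl.
  have Y0 : 0 <= Y by apply: gap.
  have h1 : ((1 + S) / E) ^+ 2 * Y <= S.
    by apply: le_trans XY; rewrite ler_wpM2r // lerXn2r ?nnegrE ?cabs_ge0 // ltW.
  have h2 : (1 + S) ^+ 2 * Y <= S * E ^+ 2.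
    by move: h1; rewrite exprMn exprVn mulrAC ler_pdivrMr // exprn_gt0.
  have E2 : 0 <= E ^+ 2 by rewrite sqr_ge0.
  have : 0 <= S * Y by rewrite mulr_ge0.
  have : 0 <= S * (S * Y) by rewrite !mulr_ge0.
  rewrite expr2 in h2; move=> h3 h4; move: (E ^+ 2) E2 h2 => e e0 h2.
  rewrite -(@ler_pM2l _ (1 + S)) ?ltr_pwDl //.
  nra.
(* Since [1 - |z| <= 1 - |z|^2 <= sqrt (1 - |z|^2)], the distances to the circle decrease, and
   sparsity against the predecessor extends to all earlier points. *)
have mono j : 1 - cabs (z j.+1) <= 1 - cabs (z j).
  have h0 : 0 <= 1 - cabs (z j) by rewrite subr_ge0 ltW.
  apply: (@le_trans _ _ (Num.sqrt (1 - cabs (z j.+1) ^+ 2))).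
    apply: (@le_trans _ _ (1 - cabs (z j.+1) ^+ 2)).
      rewrite lerD2l lerN2 expr2 -[leRHS]mulr1 ler_wpM2l ?cabs_ge0 // ltW //.
    set g := 1 - _; have g0 : 0 <= g by apply: gap.
    have g1 : g <= 1 by rewrite /g gerBl sqr_ge0.
    rewrite -{1}(sqr_sqrtr g0) expr2 -[leRHS]mulr1 ler_wpM2l ?sqrtr_ge0 //.
    by rewrite -sqrtr1 ler_sqrt.
  apply: le_trans (step j) _; rewrite ler_piMl // /eps -exprM exprn_ile1 //; lra.
have mono2 i l : (i <= l)%N -> 1 - cabs (z l) <= 1 - cabs (z i).
  elim: l => [|l IH]; first by rewrite leqn0 => /eqP ->.
  rewrite leq_eqVlt => /predU1P[-> //|]; rewrite ltnS => /IH.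
  exact: le_trans (mono l).
exists z; split=> // i [//|l]; rewrite ltnS => il; apply: le_trans (step l) _.
by rewrite ler_wpM2l ?mono2 // ltW.
Qed.

End UnboundedFunctions.

(** * Multipliers *)

Section KernelBoundary.
Variable R : realType.

Local Notation mu := (@lebesgue_measure R).

(** Only [acos (Re w)] and its reflection in [pi] can be angles of [w]. *)
Lemma ae_expi_neq (w : R[i]) : {ae mu, forall t, @angles R t -> expi t != w}.
Proof.
pose t0 := acos (complex.Re w) : R.
have n1 (t : R) : mu.-negligible [set t].
  apply/negligibleP; [exact: measurable_set1 | exact: lebesgue_measure_set1].
apply: (negligibleS _ (negligibleU (n1 t0) (n1 (2 * pi - t0)))) => t /= nt.
have [ta tw] : @angles R t /\ expi t = w.
  by move/not_implyP: nt => [ta /negP]; rewrite negbK => /eqP.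
move: ta; rewrite /angles /= in_itv /= => /andP[ta0 ta1].
have ct : cos t = complex.Re w by rewrite -tw.
have [tp|tp] := leP t pi.
  by left; rewrite /t0 -ct cosK // in_itv /= ta0.
right; rewrite /t0 -ct.
have -> : cos t = cos (2 * pi - t).
  have := cosD2pi (- t); rewrite cosN => <-; congr cos.
  by rewrite -[pi *+ 2]mulr_natr; ring.
rewrite cosK; first by ring.
by rewrite in_itv /=; apply/andP; split; lra.
Qed.

Lemma uniform_lower_bound (u : nat -> R) (d : R) J : 0 < d -> (forall j, 0 < u j) ->
  (forall j, (J <= j)%N -> d <= u j) -> exists2 e, 0 < e & forall j, e <= u j.
Proof.
move=> d0 u0; elim: J d d0 => [|J IH] d d0 uJ.
  by exists d => // j; apply: uJ.
apply: (IH (Num.min d (u J))); first by rewrite lt_min d0 u0.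
move=> j; rewrite leq_eqVlt => /predU1P[<-|Jj]; first by rewrite ge_min lexx orbT.
by rewrite ge_min uJ.
Qed.

(** On the circle [|1 - conj z_j e| = |e - z_j|]. For [e] other than [w] this is at least
    [|e - w| / 2] from some index on, and positive for the finitely many others, so the series is
    differentiable, hence continuous, at [e]. *)
Lemma kernel_series_boundary_value (z : nat -> R[i]) (w : R[i]) :
  (forall j, cabs (z j) < 1) -> (forall j, cabs (z j - w) < j.+1%:R^-1) ->
  has_boundary_value (kernel_series z).
Proof.
move=> z1 zw; exists (kernel_series z); apply: (ae_imp (ae_expi_neq w)) => t tw ta.
have {}tw := tw ta; set e := expi t in tw *; have e1 : cabs e = 1 by apply: cabs_expi.
have ee : e * conjc e = 1 by apply: expi_conjc.
have gapE j : cabs (1 - conjc (z j) * e) = cabs (e - z j).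
  have -> : 1 - conjc (z j) * e = e * conjc (e - z j).
    by rewrite rmorphB /= mulrBr ee mulrC.
  by rewrite cabsM e1 mul1r cabs_conjc.
have ew : 0 < cabs (e - w) by rewrite lt_def cabs_ge0 cabs_eq0 subr_eq0 tw.
have [J hJ] := natr_archi (cabs (e - w) / 2)^-1.
have [d d0 hd] : exists2 d, 0 < d & forall j, d <= cabs (1 - conjc (z j) * e).
  apply: (@uniform_lower_bound _ (cabs (e - w) / 2) J); first by rewrite divr_gt0.
    move=> j; apply: (@lt_le_trans _ _ (1 - cabs (z j))); first by rewrite subr_gt0.
    by rewrite gapE -e1; have := cabs_ltriangle e (z j); lra.
  move=> j Jj; rewrite gapE.
  have zj : cabs (z j - w) <= cabs (e - w) / 2.
    apply: le_trans (ltW (zw j)) _; rewrite invf_ple ?posrE ?divr_gt0 //.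
    by apply: le_trans hJ _; rewrite ler_nat ltnW // ltnS.
  have := cabsD (e - z j) (z j - w); rewrite addrA subrK; lra.
have := kernel_series_derivable z1 d0 hd => /derivable1_diffP/differentiable_continuous ce.
exact: (cvg_comp _ _ (radial_cvg e1) ce).
Qed.

End KernelBoundary.

(** * Multipliers are bounded *)

Section MultipliersBounded.
Variable R : realType.
Implicit Types (f g h phi : R[i] -> R[i]) (p q : {poly R[i]}).
Variables (N : nat) (zeta : 'I_N -> R[i]).
Hypothesis zeta1 : forall j, cabs (zeta j) = 1.

Let a : {poly R[i]} := \prod_(j < N) ('X - (zeta j)%:P).

Lemma circle_poly_disc_neq0 v : cabs v < 1 -> a.[v] != 0.
Proof.
move=> v1; rewrite horner_prod; apply/prodf_neq0 => j _; rewrite hornerXsubC subr_eq0.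
by apply: contraTneq v1 => ->; rewrite zeta1 ltxx.
Qed.

Lemma multiplier_in_range phi : multipliers (coToeplitz_range (horner a)) phi ->
  coToeplitz_range (horner a) phi.
Proof.
move=> [_ mphi]; have -> : phi = (fun z => phi z * (1 : {poly R[i]}).[z]).
  by apply/funext => z; rewrite hornerC mulr1.
apply: mphi; apply: (@range_intro _ _ zeta zeta1 _ (horner 0) 1).
- exact: analytic_disc_poly.
- exact: H2_poly.
- exact: has_boundary_value_poly.
- by move=> z _; rewrite horner0 mulr0 add0r.
Qed.

Lemma H2_growth f : H2 f -> exists2 S, 0 <= S & forall z, cabs z < 1 ->
  cabs (f z) ^+ 2 * (1 - cabs z ^+ 2) <= S.
Proof.
move=> /H2P[_ [c [S [cS fc]]]]; exists S; first exact: l2_bound_ge0 cS.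
by move=> z; apply: taylor_growth fc cS.
Qed.

Lemma radial_growth f (S : R) (w : R[i]) (r : R) :
  (forall z, cabs z < 1 -> cabs (f z) ^+ 2 * (1 - cabs z ^+ 2) <= S) ->
  cabs w = 1 -> 0 <= r < 1 -> (1 - r) * cabs (f (r%:C * w)) ^+ 2 <= S.
Proof.
move=> fS w1 /andP[r0 r1].
have rw : cabs (r%:C * w) = r by rewrite cabsM cabs_real w1 mulr1 ger0_norm.
have := fS (r%:C * w); rewrite rw => /(_ r1); apply: le_trans.
rewrite mulrC ler_wpM2l ?sqr_ge0 //; nra.
Qed.

Lemma multiplier_Hinf phi : multipliers (coToeplitz_range (horner a)) phi -> Hinf phi.
Proof.
move=> mphi; split; first exact: mphi.1.
suff [M phiM] : exists M, forall z, cabs z < 1 -> cabs (phi z) <= M.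
  exists M%:C => z; rewrite normr_cabs (ltcR (cabs z) 1) => z1.
  by rewrite normr_cabs lecR phiM.
apply: contrapT => /unbounded_cluster [w hw].
have [Hphi _ [h1 [q1 [Hh1 _ _ phiE]]]] :=
  range_decomposition zeta1 (multiplier_in_range mphi).
have [Sphi _ phiS] := H2_growth Hphi.
have [z [z1 zw z8 sparse]] := sparse_sequence phiS hw.
pose h := kernel_series z.
have Hh : H2 h := kernel_series_H2 z1.
have bh : has_boundary_value h := kernel_series_boundary_value z1 zw.
have Mf : coToeplitz_range (horner a) (fun v => a.[v] * h v).
  apply: (@range_intro _ _ zeta zeta1 _ h 0); [|exact: Hh|exact: bh|].
    by apply: analytic_discM; [apply: analytic_disc_poly | case: Hh].
  by move=> v _; rewrite horner0 addr0.
have [_ _ [k [q [Hk _ qN phifE]]]] := range_decomposition zeta1 (mphi.2 _ Mf).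
have [S1 S10 h1S] := H2_growth Hh1; have [Sh Sh0 hS] := H2_growth Hh.
have [Sk Sk0 kS] := H2_growth Hk.
pose psi v := phi v * h v - k v.
have qE v : cabs v < 1 -> q.[v] = a.[v] * psi v.
  move=> v1; have := phifE v v1; rewrite -/a /psi => e.
  transitivity (phi v * (a.[v] * h v) - a.[v] * k v); last by ring.
  by rewrite e; ring.
have q0 : q = 0.
  pose s := [seq zeta j | j <- enum 'I_N].
  have sa : \prod_(v <- s) ('X - v%:P) = a by rewrite /s big_map big_enum.
  apply: (@radial_bound_poly_eq0 _ s psi).
  - by move=> v /mapP[j _ ->].
  - move=> v /mapP[j _ ->]; set v0 := zeta j; have v01 : cabs v0 = 1 := zeta1 j.
    have /factor_theorem [b bE] : root a v0.
      by rewrite /root horner_prod (bigD1 j) //= hornerXsubC subrr mul0r.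
    have [Mb Mb0 bM] := horner_bounded b; have [Mq Mq0 qM] := horner_bounded q1.
    pose C1 := 2 * (Mb ^+ 2 * S1) + 2 * Mq ^+ 2.
    exists (2 * (C1 * Sh) + 2 * Sk) => r r01; have /andP[r0 r1] := r01.
    have rw : cabs (r%:C * v0) = r by rewrite cabsM cabs_real v01 mulr1 ger0_norm.
    have r1' : 0 <= 1 - r by rewrite subr_ge0 ltW.
    have hh1 := radial_growth h1S v01 r01; have hh := radial_growth hS v01 r01.
    have hk := radial_growth kS v01 r01.
    have rw1 : cabs (r%:C * v0) < 1 by rewrite rw.
    (* At the zero [v0], [a] has a factor of modulus [1 - r], and
       [(1 - r)^2 |h1|^2 <= (1 - r) |h1|^2 <= S1]. *)
    have phi_bnd : cabs (phi (r%:C * v0)) ^+ 2 <= C1.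
      rewrite phiE // -/a bE hornerM hornerXsubC.
      have -> : r%:C * v0 - v0 = - ((1 - r)%:C * v0).
        by rewrite rmorphB rmorph1 mulrBl mul1r opprB.
      have bb : cabs b.[r%:C * v0] ^+ 2 <= Mb ^+ 2.
        by rewrite lerXn2r ?nnegrE ?cabs_ge0 // bM // ltW.
      have qq : cabs q1.[r%:C * v0] ^+ 2 <= Mq ^+ 2.
        by rewrite lerXn2r ?nnegrE ?cabs_ge0 // qM // ltW.
      set x := b.[_] * _ * _.
      have xx : cabs x ^+ 2 <= Mb ^+ 2 * S1.
        rewrite /x !cabsM cabsN cabsM v01 mulr1 cabs_real ger0_norm // !exprMn -mulrA.
        apply: ler_pM; rewrite ?sqr_ge0 ?(mulr_ge0 (sqr_ge0 _) (sqr_ge0 _)) //.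
        apply: le_trans hh1; rewrite ler_wpM2r ?sqr_ge0 //; nra.
      have := cabsD x q1.[r%:C * v0]; have := cabs_ge0 (x + q1.[r%:C * v0]).
      have := sqr_ge0 (cabs x - cabs q1.[r%:C * v0]); rewrite /C1.
      by move: (cabs x) (cabs q1.[_]) (cabs (x + _)) xx qq => X Y Z; nra.
    have := cabsD (phi (r%:C * v0) * h (r%:C * v0)) (- k (r%:C * v0)).
    have := cabs_ge0 (psi (r%:C * v0)); rewrite cabsN cabsM -/(psi _).
    move: (cabs (psi _)) (cabs (phi _)) (cabs (h _)) (cabs (k _)) hh hk phi_bnd.
    move=> P F H K hH hK hF P0 PFH.
    have PP : P ^+ 2 <= 2 * (F ^+ 2 * H ^+ 2) + 2 * K ^+ 2.
      by have := sqr_ge0 (F * H - K); nra.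
    apply: (@le_trans _ _ (2 * (F ^+ 2 * ((1 - r) * H ^+ 2)) + 2 * ((1 - r) * K ^+ 2))).
      have -> : 2 * (F ^+ 2 * ((1 - r) * H ^+ 2)) + 2 * ((1 - r) * K ^+ 2) =
        (1 - r) * (2 * (F ^+ 2 * H ^+ 2) + 2 * K ^+ 2) by ring.
      by rewrite ler_wpM2l.
    apply: lerD; rewrite ler_pM2l //.
    by apply: ler_pM; rewrite ?sqr_ge0 ?(mulr_ge0 r1' (sqr_ge0 _)).
  - by rewrite size_map size_enum_ord.
  - by rewrite sa.
have kE v : cabs v < 1 -> k v = phi v * h v.
  move=> v1; apply/esym/eqP; rewrite -subr_eq0 -/(psi v).
  have := qE v v1; rewrite q0 horner0 => /esym/eqP.
  by rewrite mulf_eq0 (negbTE (circle_poly_disc_neq0 v1)).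
(* Any [n >= Sk] gives the contradiction [2^n <= 4^n <= Sk <= n]. *)
have [n Skn] := natr_archi Sk.
have hz := kernel_series_ge z1 n sparse; rewrite -/h in hz.
have pz := z8 n.
have kz := kS (z n) (z1 n); rewrite kE // cabsM in kz.
have s2 : Num.sqrt (1 - cabs (z n) ^+ 2) ^+ 2 = 1 - cabs (z n) ^+ 2.
  by rewrite sqr_sqrtr // subr_ge0 expr_le1 ?cabs_ge0 // ltW.
rewrite -s2 -exprMn -mulrA in kz.
have lb : 2 ^+ n <= cabs (phi (z n)) * (cabs (h (z n)) * Num.sqrt (1 - cabs (z n) ^+ 2)).
  have -> : 2 ^+ n = 8 ^+ n.+1 * ((2^-1 ^+ n.+1) ^+ 2 / 2) :> R.
    rewrite mulrA exprAC -exprMn; have -> : 8 * 2^-1 ^+ 2 = 2 :> R by field.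
    by rewrite exprS mulrC mulKf.
  by apply: ler_pM; rewrite ?divr_ge0 ?exprn_ge0.
have one : 1 <= 2 ^+ n :> R by rewrite exprn_ege1 // ler1n.
have : 2 ^+ n <= Sk.
  apply: le_trans kz; apply: (@le_trans _ _ ((2 ^+ n) ^+ 2)).
    by rewrite expr2 ler_peMl // (le_trans _ one).
  by rewrite lerXn2r ?nnegrE // ?(le_trans _ lb) ?exprn_ge0.
move=> /le_trans /(_ Skn); rewrite -natrX ler_nat leqNgt ltn_expl //.
Qed.

End MultipliersBounded.

Theorem proposition3p1 (R : realType) (a : {poly R[i]}) (ha : circle_polys a) :
  multipliers (coToeplitz_range (horner a)) =
  coToeplitz_range (horner a) `&` @Hinf R.
Proof.
case: ha => N [zeta [zetaC ->]].
have zeta1 j : cabs (zeta j) = 1.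
  by have /(congr1 (@complex.Re R)) := zetaC j.
apply/seteqP; split=> [phi mphi|phi [Mphi Iphi]].
  by split; [apply: multiplier_in_range | apply: multiplier_Hinf zeta1 _ mphi].
split; first exact: Iphi.1.
by move=> f Mf; apply: bounded_range_multiplier.
Qed.
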